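(* Let $n,k\geq 1$ be integers. The multiplication map $$\phi^{(n,k)}:\ \mathcal{I}(M_{k\times n})\otimes \mathcal{H}(M_{k\times n})\to \mathcal{P}(M_{k\times n}),\qquad I\otimes H\mapsto IH,$$ is injective if and only if $n\geq 2k-1$.
   Context: $M_{k\times n}$ is the space of complex $k\times n$ matrices with coordinate functions $x_{ij}$ ($1\le i\le k$, $1\le j\le n$), and $\mathcal{P}(M_{k\times n})=\mathbb{C}[x_{11},x_{12},\dots,x_{kn}]$. $O(n)=O(n,\mathbb{C})$ is the group of complex $n\times n$ matrices preserving the symmetric bilinear form $(u,v)=u_1v_n+u_2v_{n-1}+\dots+u_nv_1$ on $\mathbb{C}^n$; it acts on $\mathcal{P}(M_{k\times n})$ by $(g\cdot P)(x)=P(xg)$. $\mathcal{I}(M_{k\times n})\subset\mathcal{P}(M_{k\times n})$ is the ring of $O(n)$-invariant polynomials; it is generated by $r_{ij}=\sum_{l=1}^n x_{il}x_{j,n+1-l}$, $1\le i\le j\le k$. $\mathcal{H}(M_{k\times n})\subset\mathcal{P}(M_{k\times n})$ is the space of harmonic polynomials, i.e. the common kernel of the operators $\Delta_{ij}=\sum_{l=1}^n \partial_{x_{il}}\partial_{x_{j,n+1-l}}$, $1\le i\le j\le k$. The tensor product is over $\mathbb{C}$, and $IH$ is the product of polynomials. *)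

(* Defs.v *)
From HB Require Import structures.
From mathcomp Require Import all_boot all_order all_algebra generic_quotient.
From mathcomp Require Import ring_quotient boolp.
From mathcomp Require Export reals complex mpoly freeg.

Set Implicit Arguments.
Unset Strict Implicit.
Unset Printing Implicit Defensive.

Import GRing.Theory.

Local Open Scope ring_scope.
Local Open Scope quotient_scope.

Section TensorProduct.
Variables (F : fieldType) (U V : lmodType F).

(* The F-subspace of the free F-module on U * V spanned by the bilinearity
   relations. *)
Inductive tensor_relation : {freeg (U * V) / F} -> Prop :=
| TensorAddl u1 u2 v :
    tensor_relation (<< (u1 + u2, v) >> - << (u1, v) >> - << (u2, v) >>)
| TensorAddr u v1 v2 :
    tensor_relation (<< (u, v1 + v2) >> - << (u, v1) >> - << (u, v2) >>)
| TensorScalel a u v :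
    tensor_relation (<< (a *: u, v) >> - a *: << (u, v) >>)
| TensorScaler a u v :
    tensor_relation (<< (u, a *: v) >> - a *: << (u, v) >>)
| TensorZero : tensor_relation 0
| TensorLin a d e :
    tensor_relation d -> tensor_relation e -> tensor_relation (a *: d + e).

Definition tensor_null : {pred {freeg (U * V) / F}} :=
  fun d => `[< tensor_relation d >].

Fact tensor_null_submod_closed : submod_closed tensor_null.
Proof.
split=> [|a d e /asboolP dN /asboolP eN]; apply/asboolP; first exact: TensorZero.
exact: TensorLin.
Qed.

HB.instance Definition _ :=
  GRing.isSubmodClosed.Build F {freeg (U * V) / F} tensor_null
    tensor_null_submod_closed.

Definition tensor := {ideal_quot tensor_null}.

HB.instance Definition _ := GRing.Zmodule.on tensor.
HB.instance Definition _ := Quotient.on tensor.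

Definition tensor_class (d : {freeg (U * V) / F}) : tensor := \pi_tensor d.

Lemma tensor_classP d e :
  reflect (tensor_class d = tensor_class e) (d - e \in tensor_null).
Proof. by rewrite Quotient.idealrBE; apply: eqP. Qed.

Lemma tensor_class_repr (t : tensor) : tensor_class (repr t) = t.
Proof. exact: reprK. Qed.

Lemma tensor_classB : {morph tensor_class : d e / d - e}.
Proof.
by move=> d e; rewrite /tensor_class [LHS](Quotient.pi_add _ _) Quotient.pi_opp.
Qed.

HB.instance Definition _ := GRing.isZmodMorphism.Build _ _ tensor_class
  tensor_classB.

Definition tensor_scale (a : F) (t : tensor) : tensor :=
  tensor_class (a *: repr t).

Lemma tensor_class_scale a d :
  tensor_class (a *: d) = tensor_scale a (tensor_class d).
Proof.
apply/tensor_classP; rewrite -scalerBr rpredZ //.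
by apply/tensor_classP; rewrite tensor_class_repr.
Qed.

Fact tensor_scaleA a b t :
  tensor_scale a (tensor_scale b t) = tensor_scale (a * b) t.
Proof.
by rewrite -(tensor_class_repr t) -!tensor_class_scale scalerA.
Qed.

Fact tensor_scale1 : left_id 1 tensor_scale.
Proof. by move=> t; rewrite /tensor_scale scale1r tensor_class_repr. Qed.

Fact tensor_scaleDr : right_distributive tensor_scale +%R.
Proof.
move=> a t s; rewrite -(tensor_class_repr t) -(tensor_class_repr s).
by rewrite -raddfD -!tensor_class_scale scalerDr raddfD.
Qed.

Fact tensor_scaleDl t : {morph tensor_scale^~ t : a b / a + b}.
Proof. by move=> a b; rewrite /tensor_scale scalerDl raddfD. Qed.

HB.instance Definition _ := GRing.Zmodule_isLmodule.Build F tensor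
  tensor_scaleA tensor_scale1 tensor_scaleDr tensor_scaleDl.

HB.instance Definition _ := GRing.isScalable.Build F _ _ _ tensor_class
  tensor_class_scale.

Definition tens (u : U) (v : V) : tensor := tensor_class << (u, v) >>.

Lemma tensDl u1 u2 v : tens (u1 + u2) v = tens u1 v + tens u2 v.
Proof.
rewrite /tens -raddfD; apply/tensor_classP.
by rewrite opprD addrA; apply/asboolP/TensorAddl.
Qed.

Lemma tensDr u v1 v2 : tens u (v1 + v2) = tens u v1 + tens u v2.
Proof.
rewrite /tens -raddfD; apply/tensor_classP.
by rewrite opprD addrA; apply/asboolP/TensorAddr.
Qed.

Lemma tensZl a u v : tens (a *: u) v = a *: tens u v.
Proof. by rewrite /tens -linearZ; apply/tensor_classP/asboolP/TensorScalel. Qed.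

Lemma tensZr a u v : tens u (a *: v) = a *: tens u v.
Proof. by rewrite /tens -linearZ; apply/tensor_classP/asboolP/TensorScaler. Qed.

Lemma freeg_fglift_linear (K : choiceType) (W : lmodType F) (f : K -> W) :
  linear (fglift f).
Proof.
have liftB : {morph fglift f : d e / d - e} by exact: lift_is_additive.
pose lA : {additive {freeg K / F} -> W} :=
  HB.pack (fglift f) (GRing.isZmodMorphism.Build _ _ (fglift f) liftB).
move=> a d e; rewrite -[fglift f]/(lA : _ -> _) raddfD; congr (_ + _).
rewrite -[d in RHS]freeg_sumE [_ *: d]/(fgscale a d) /fgscale !raddf_sum.
by apply: eq_bigr => x _; rewrite /= !liftU scalerA.
Qed.

Lemma tens_sumE (t : tensor) :
  exists s : seq (U * V), t = \sum_(x <- s) tens x.1 x.2.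
Proof.
exists [seq (coeff z (repr t) *: z.1, z.2) | z <- dom (repr t)].
rewrite big_map -[LHS]tensor_class_repr -[in LHS](freeg_sumE (repr t)) raddf_sum.
apply: eq_bigr => -[u v] _ /=; rewrite tensZl /tens -linearZ; congr tensor_class.
apply/eqP/freeg_eqP => y.
by rewrite coeffZ !coeffU mul1r.
Qed.

Section Lift.
Variables (W : lmodType F) (f : U -> V -> W).

(* The unique linear map sending tens u v to f u v when f is bilinear, see
   tensor_liftE and tensor_lift_linear. *)
Definition tensor_lift (t : tensor) : W :=
  fglift (fun x => f x.1 x.2) (repr t).

Hypothesis fl : forall v, linear (f^~ v).
Hypothesis fr : forall u, linear (f u).

Lemma tensor_lift_null d :
  d \in tensor_null -> fglift (fun x => f x.1 x.2) d = 0.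
Proof.
set l := fglift _.
have lin_l : linear l by apply: freeg_fglift_linear.
have lB d1 d2 : l (d1 - d2) = l d1 - l d2 by apply: lift_is_additive.
have l0 : l 0 = 0 by rewrite -(subrr 0) lB subrr.
have lZ a d1 : l (a *: d1) = a *: l d1 by rewrite -[_ *: d1]addr0 lin_l l0 addr0.
have lU u v : l << (u, v) >> = f u v by rewrite /l liftU scale1r.
have fDl u1 u2 v : f (u1 + u2) v = f u1 v + f u2 v.
  by have := fl v 1 u1 u2; rewrite !scale1r.
have fDr u v1 v2 : f u (v1 + v2) = f u v1 + f u v2.
  by have := fr u 1 v1 v2; rewrite !scale1r.
have f0l v : f 0 v = 0 by apply: (addrI (f 0 v)); rewrite -fDl !addr0.
have f0r u : f u 0 = 0 by apply: (addrI (f u 0)); rewrite -fDr !addr0.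
have fZl a u v : f (a *: u) v = a *: f u v.
  by have := fl v a u 0; rewrite f0l !addr0.
have fZr a u v : f u (a *: v) = a *: f u v.
  by have := fr u a v 0; rewrite f0r !addr0.
move=> /asboolP; elim=> {d} [u1 u2 v|u v1 v2|a u v|a u v||a d e _ dN _ eN].
- by rewrite !lB !lU fDl -addrA -opprD subrr.
- by rewrite !lB !lU fDr -addrA -opprD subrr.
- by rewrite lB lZ !lU fZl subrr.
- by rewrite lB lZ !lU fZr subrr.
- exact: l0.
- by rewrite lin_l dN eN scaler0 addr0.
Qed.

Lemma tensor_lift_class d :
  tensor_lift (tensor_class d) = fglift (fun x => f x.1 x.2) d.
Proof.
have liftB := @lift_is_additive F (U * V)%type W (fun x => f x.1 x.2).
apply/eqP; rewrite -subr_eq0 -liftB; apply/eqP/tensor_lift_null.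
by apply/tensor_classP; rewrite tensor_class_repr.
Qed.

Lemma tensor_liftE u v : tensor_lift (tens u v) = f u v.
Proof. by rewrite tensor_lift_class liftU scale1r. Qed.

Lemma tensor_lift_linear : linear tensor_lift.
Proof.
move=> a s t; rewrite -(tensor_class_repr s) -(tensor_class_repr t) -linearP.
by rewrite !tensor_lift_class freeg_fglift_linear.
Qed.

End Lift.
End TensorProduct.

Section HarmonicPolynomials.
Variables (F : fieldType) (k n : nat).

Local Notation P := {mpoly F[k * n]}.

(* The coordinate x_ij is the variable of index mxvec_index i j. *)
Definition coordX (i : 'I_k) (j : 'I_n) : P := 'X_(mxvec_index i j).

Definition genericX : 'M[P]_(k, n) := \matrix_(i, j) coordX i j.

Definition mpoly_subst (p : P) (Y : 'M[P]_(k, n)) : P :=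
  p \mPo [tuple mxvec Y 0 l | l < k * n].

(* (u, v) = u_1 v_n + u_2 v_(n-1) + ... + u_n v_1. *)
Definition antiform (u v : 'cV[F]_n) : F := \sum_(l < n) u l 0 * v (rev_ord l) 0.

(* The matrix J of antiform satisfies J * J = 1, so g^T J g = J if and only if
   g J g^T = J: preserving the form on columns (u |-> g u) or on rows
   (u |-> u g) defines the same group. *)
Definition in_On (g : 'M[F]_n) : Prop :=
  forall u v : 'cV[F]_n, antiform (g *m u) (g *m v) = antiform u v.

(* (g . p)(x) = p (x g). *)
Definition On_act (g : 'M[F]_n) (p : P) : P :=
  mpoly_subst p (genericX *m map_mx (@mpolyC (k * n) F) g).

Definition invariant : {pred P} :=
  fun p => `[< forall g : 'M[F]_n, in_On g -> On_act g p = p >].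

Fact invariant_submod_closed : submod_closed invariant.
Proof.
split=> [|a p q /asboolP pI /asboolP qI]; apply/asboolP => g gO.
  exact: comp_mpoly0.
by rewrite /On_act /mpoly_subst linearP /=; congr (_ *: _ + _);
  [exact: pI | exact: qI].
Qed.

HB.instance Definition _ :=
  GRing.isSubmodClosed.Build F P invariant invariant_submod_closed.

Record invariants := Invariant {
  invariant_val :> P;
  _ : invariant_val \in invariant
}.

HB.instance Definition _ := [isSub for invariant_val].
HB.instance Definition _ := [Choice of invariants by <:].
HB.instance Definition _ := [SubChoice_isSubLmodule of invariants by <:].

Definition Delta (i j : 'I_k) (p : P) : P :=
  \sum_(l < n) (p^`M(mxvec_index j (rev_ord l)))^`M(mxvec_index i l).

Fact Delta_linear i j : linear (Delta i j).
Proof.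
move=> a p q; rewrite /Delta scaler_sumr -big_split /=.
by apply: eq_bigr => l _; rewrite !linearP.
Qed.

HB.instance Definition _ i j :=
  GRing.isLinear.Build F P P _ (Delta i j) (Delta_linear i j).

Definition harmonic : {pred P} :=
  fun p => [forall i : 'I_k, forall j : 'I_k, (i <= j)%N ==> (Delta i j p == 0)].

Fact harmonic_submod_closed : submod_closed harmonic.
Proof.
split=> [|a p q pH qH]; apply/'forall_forallP => i j; apply/implyP => le_ij.
  by rewrite raddf0.
have /forallP/(_ j)/implyP/(_ le_ij)/eqP Dp := forallP pH i.
have /forallP/(_ j)/implyP/(_ le_ij)/eqP Dq := forallP qH i.
by rewrite Delta_linear Dp Dq scaler0 addr0.
Qed.

HB.instance Definition _ :=
  GRing.isSubmodClosed.Build F P harmonic harmonic_submod_closed.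

Record harmonics := Harmonic {
  harmonic_val :> P;
  _ : harmonic_val \in harmonic
}.

HB.instance Definition _ := [isSub for harmonic_val].
HB.instance Definition _ := [Choice of harmonics by <:].
HB.instance Definition _ := [SubChoice_isSubLmodule of harmonics by <:].

Definition IH_mul (p : invariants) (h : harmonics) : P := val p * val h.

Fact IH_mul_linearl h : linear (IH_mul^~ h).
Proof. by move=> a p q; rewrite /IH_mul linearP mulrDl scalerAl. Qed.

Fact IH_mul_linearr p : linear (IH_mul p).
Proof. by move=> a h g; rewrite /IH_mul linearP mulrDr scalerAr. Qed.

Definition mul_IH : tensor invariants harmonics -> P := tensor_lift IH_mul.

HB.instance Definition _ := GRing.isLinear.Build F _ P _ mul_IH
  (tensor_lift_linear IH_mul_linearl IH_mul_linearr).

Lemma mul_IH_tens p h : mul_IH (tens p h) = val p * val h.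
Proof. exact: tensor_liftE IH_mul_linearl IH_mul_linearr p h. Qed.

End HarmonicPolynomials.

(* Main.v *)
From HB Require Import structures.
Require Import Defs.
From mathcomp Require Import all_boot all_order all_algebra.
From mathcomp Require Import reals complex mpoly.
From mathcomp Require Import boolp ssrcomplements ring zify.

(** Let [X] be the generic [k * n] matrix and [J] the antidiagonal permutation
    matrix, so that the quadrics [r_ij] are the entries of the Gram matrix
    [X J X^T] of the rows of [X].

    Suppose [2 k - 1 <= n].  Three facts make the multiplication injective.

    - Every invariant is a polynomial in the [r_ij] (invariant_squad).  Stacking
      [k - 1] hyperbolic planes and one anisotropic line gives a matrix
      [Y (r, s)], polynomial in a symmetric matrix [r] and a scalar [s], whose
      Gram matrix is [r] whenever [s ^ 2] is the right multiple of the last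
      diagonal entry of [r].  Two matrices with the same Gram matrix are, in
      general position, exchanged by an explicit orthogonal reflection, so an
      invariant [p] satisfies [p (X) = p (Y (r (X), s))]; the right hand side is
      even in [s], hence polynomial in [r (X)].
    - For a suitable weight on the variables, the [r_ij] with [i <= j] have
      pairwise coprime leading monomials (squad_leads, lead_mnm_coprime).  So the
      products of powers of the [r_ij] by the monomials divisible by no leading
      monomial form a basis, just as for the leading monomials themselves, and
      a relation [\sum_b r^b G_b = 0] whose coefficients [G_b] lie in a space
      that meets the ideal of the [r_ij] trivially has all [G_b = 0]
      (rpow_independent).
    - The harmonic polynomials form such a space (harmonic_ideal_eq0): [Delta_ij]
      is adjoint to the multiplication by [r_ij] for the Fischer inner product,
      which is positive definite.

    By the first fact an element of the tensor product is a sum of tensors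
    [tens (r^b) (G_b)]; if its image vanishes, the other two give [G_b = 0].

    Suppose [n <= 2 k - 2] and write [n = a + b] with [b <= a <= b + 1].  Let [c]
    be the vector of the signed [a * a] minors of the first [a] columns of [X]
    on [a + 1] rows, and [d] the same for [b].  Cramer's rule makes [c] orthogonal
    to the first [a] columns and [d] to the first [b] ones.  In [c^T X J X^T d]
    column [l] meets column [n + 1 - l], and [l <= a] or [n + 1 - l <= b], so that
    [\sum_ij r_ij c_i d_j = 0].  As [c_i d_j] is harmonic, this is the image of
    [\sum_ij tens (r_ij) (c_i d_j)], which a product of two evaluations detects as a
    nonzero tensor. *)

Set Implicit Arguments.
Unset Strict Implicit.
Unset Printing Implicit Defensive.

Import Order.TTheory GRing.Theory Num.Theory.
Local Open Scope ring_scope.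

(** * Polynomials that vanish at every point *)

Lemma digits_inj (D n : nat) (a b : 'I_n -> nat) :
  (forall i, a i < D)%N -> (forall i, b i < D)%N ->
  (\sum_(i < n) a i * D ^ i = \sum_(i < n) b i * D ^ i)%N -> a =1 b.
Proof.
elim: n a b => [|n IHn] a b aD bD; first by move=> _ [].
have step (c : 'I_n.+1 -> nat) : (\sum_(i < n.+1) c i * D ^ i
    = \sum_(i < n) c (lift ord0 i) * D ^ i * D + c ord0)%N.
  rewrite big_ord_recl /= expn0 muln1 addnC; congr (_ + _)%N.
  by apply: eq_bigr => i _; rewrite -mulnA -expnSr.
rewrite !step -!big_distrl /= => eq_ab.
have D0 : (0 < D)%N by apply: leq_ltn_trans (aD ord0).
have ab0 : a ord0 = b ord0.
  by move/(congr1 (modn^~ D)): eq_ab; rewrite !modnMDl !modn_small.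
have/IHn ab : (\sum_(i < n) a (lift ord0 i) * D ^ i
             = \sum_(i < n) b (lift ord0 i) * D ^ i)%N.
  by move/(congr1 (divn^~ D)): eq_ab; rewrite !divnMDl // !divn_small ?addn0.
by move=> i; case: (unliftP ord0 i) => [j ->|->] //; apply: ab.
Qed.

Lemma poly_eq0_eval (F : numFieldType) (q : {poly F}) :
  (forall x, q.[x] = 0) -> q = 0.
Proof.
move=> q0; apply/eqP; apply: contraTT isT => nz_q.
have := @max_poly_roots F q [seq i%:R | i <- iota 0 (size q)] nz_q.
rewrite size_map size_iota ltnn; apply; first by apply/allP => x _; apply/eqP.
by rewrite map_inj_uniq ?iota_uniq // => i j /eqP; rewrite eqr_nat => /eqP.
Qed.

(** Kronecker's substitution [x_i := x ^ (D ^ i)], with [D] larger than every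
    exponent, keeps the monomials apart and reduces the claim to one variable. *)
Lemma mpoly_eq0_meval (F : numFieldType) (N : nat) (p : {mpoly F[N]}) :
  (forall v : 'I_N -> F, p.@[v] = 0) -> p = 0.
Proof.
move=> p0; pose D := msize p.
have ltD m i : m \in msupp p -> (m i < D)%N.
  move/msize_mdeg_lt; apply: leq_ltn_trans.
  by rewrite mdegE (bigD1 i) //= leq_addr.
pose e (m : 'X_{1..N}) := (\sum_(i < N) m i * D ^ i)%N.
pose q := \sum_(m <- msupp p) p@_m *: 'X^(e m) : {poly F}.
have q0 : q = 0.
  apply: poly_eq0_eval => x; rewrite -(p0 (fun i => x ^+ (D ^ i))) mevalE.
  rewrite horner_sum; apply: eq_bigr => m _; rewrite hornerZ hornerXn.
  congr (_ * _); rewrite -[LHS]prodrXr; apply: eq_bigr => i _.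
  by rewrite -exprM mulnC.
apply/mpolyP => m; rewrite mcoeff0; case: (boolP (m \in msupp p)) => [mp|].
  have := congr1 (fun r : {poly F} => r`_(e m)) q0.
  rewrite coef0 coef_sum (bigD1_seq m) ?msupp_uniq //= coefZ coefXn eqxx mulr1.
  rewrite big_seq_cond big1 ?addr0 // => m' /andP[m'p ne]; rewrite coefZ coefXn.
  case: eqP => [/digits_inj eq_m|_]; last by rewrite mulr0.
  case/eqP: ne; apply/mnmP => i; rewrite -eq_m // => j; exact: ltD.
by move/memN_msupp_eq0.
Qed.

(** * Polynomials with pairwise coprime leading monomials *)

Section LinearExtension.
Variables (F : fieldType) (d : nat) (V : lmodType F) (f : 'X_{1..d} -> V).

Definition mlin (p : {mpoly F[d]}) : V := \sum_(m <- msupp p) p@_m *: f m.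

Lemma mlinwE D p :
  (msize p <= D)%N -> mlin p = \sum_(m : 'X_{1..d < D}) p@_m *: f m.
Proof.
move=> le_pD; rewrite /mlin (big_mksub 'X_{1..d < D}) ?msupp_uniq //=; last first.
  by move=> m /msize_mdeg_lt /leq_trans; apply.
rewrite big_rmcond //= => m /memN_msupp_eq0 ->; exact: scale0r.
Qed.

Fact mlin_linear : linear mlin.
Proof.
move=> a p q; pose D := maxn (msize (a *: p + q)) (maxn (msize p) (msize q)).
rewrite !(@mlinwE D) ?leq_max ?leqnn ?orbT // scaler_sumr -big_split /=.
by apply: eq_bigr => m _; rewrite mcoeffD mcoeffZ scalerDl scalerA.
Qed.

HB.instance Definition _ :=
  GRing.isLinear.Build F {mpoly F[d]} V _ mlin mlin_linear.

Lemma mlinX m : mlin 'X_[m] = f m.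
Proof. by rewrite /mlin msuppX big_seq1 mcoeffX eqxx scale1r. Qed.

End LinearExtension.

Section LeadingTerm.
Variables (F : idomainType) (d : nat) (w : measure d).
Implicit Types (p q : {mpoly F[d]}) (m : 'X_{1..d}).

Definition below t p := {in msupp p, forall m, (w m < t)%N}.

(** The leading monomial is the only one of maximal weight; lower monomials may
    have equal weights. *)
Definition leads m p := exists2 c, c != 0 & below (w m) (p - c *: 'X_[m]).

Lemma belowD t p q : below t p -> below t q -> below t (p + q).
Proof.
by move=> pt qt m /msuppD_le; rewrite mem_cat => /orP[/pt | /qt].
Qed.

Lemma belowZ t c p : below t p -> below t (c *: p).
Proof. by move=> pt m /msuppZ_le /pt. Qed.

Lemma belowM s t p q : below s p -> below t.+1 q -> below (s + t) (p * q).
Proof.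
move=> ps qt m /msuppM_le /allpairsP[[m1 m2] [/= /ps m1s /qt m2t ->]].
by rewrite mfD; lia.
Qed.

Lemma below_leads m p : leads m p -> below (w m).+1 p.
Proof.
case=> c _ pm; rewrite -[p](subrK (c *: 'X_[m])); apply: belowD => [m' /pm/ltnW //|].
by apply: belowZ => m'; rewrite msuppX inE => /eqP->.
Qed.

Lemma leadsX m : leads m 'X_[m].
Proof.
exists 1; first exact: oner_neq0.
by move=> m'; rewrite scale1r subrr msupp0.
Qed.

Lemma leadsM m1 m2 p q : leads m1 p -> leads m2 q -> leads (m1 + m2)%MM (p * q).
Proof.
move=> pm1 [b nz_b qm2]; have pm1S := below_leads pm1; case: pm1 => a nz_a pm1.
exists (a * b); first by rewrite mulf_neq0.
have -> : p * q - (a * b) *: 'X_[m1 + m2] =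
    (p - a *: 'X_[m1]) * (b *: 'X_[m2]) + (q - b *: 'X_[m2]) * p.
  by rewrite mpolyXD -scalerA scalerAr scalerAl; ring.
rewrite mfD; apply: belowD; last by rewrite addnC; exact: belowM.
by apply: belowM => //; apply: belowZ => m'; rewrite msuppX inE => /eqP->.
Qed.

Lemma mcoeff_leads m p : leads m p -> p@_m != 0.
Proof.
case=> c nz_c pm; have : m \notin msupp (p - c *: 'X_[m]).
  by apply/negP => /pm; rewrite ltnn.
move/memN_msupp_eq0/eqP.
by rewrite mcoeffB mcoeffZ mcoeffX eqxx mulr1 subr_eq0 => /eqP->.
Qed.

Lemma ltn_leads m m' p : leads m p -> m' \in msupp p -> m' != m -> (w m' < w m)%N.
Proof.
case=> c _ pm; rewrite mcoeff_msupp => nz_p ne; apply: pm.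
rewrite mcoeff_msupp mcoeffB mcoeffZ mcoeffX [m == _]eq_sym (negbTE ne) mulr0 subr0.
exact: nz_p.
Qed.

End LeadingTerm.

Section Multiplicity.
Variables (d : nat).
Implicit Types (a m : 'X_{1..d}).

(** The multiplicity of [a] as a factor of [m]; unless [a] is 1, it is at most the
    degree of [m]. *)
Definition mnm_mult a m :=
  (\max_(b < (mdeg m).+1 | ((a *+ b) <= m)%MM) b)%N.

(** Multiplicities are compared only through this adjunction, which turns
    every question about them into one about exponents. *)
Lemma leq_mnm_mult a m b :
  a != 0%MM -> (b <= mnm_mult a m)%N = (a *+ b <= m)%MM.
Proof.
move=> nz_a; apply/idP/idP => [|le_abm].
  have c0 : (a *+ @ord0 (mdeg m) <= m)%MM.
    by apply/mnm_lepP => i; rewrite mulmnE muln0.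
  have [|c ca max_c] := @eq_bigmax_cond _
    (fun b : 'I_(mdeg m).+1 => (a *+ b <= m)%MM) (fun b => val b).
    by apply/card_gt0P; exists ord0.
  rewrite [mnm_mult a m]max_c => le_bc; apply: lepm_trans ca; apply/mnm_lepP => i.
  by rewrite !mulmnE leq_mul2l le_bc orbT.
have le_bm : (b < (mdeg m).+1)%N.
  have [i nz_ai] : exists i, a i != 0%N.
    apply/existsP; apply: contraR nz_a => /existsPn a0.
    by apply/eqP/mnmP => i; rewrite mnm0E; apply/eqP/negPn/a0.
  move/mnm_lepP/(_ i): le_abm; rewrite mulmnE mdegE (bigD1 i) //=; nia.
exact: (@leq_bigmax_cond _ (fun b : 'I_(mdeg m).+1 => (a *+ b <= m)%MM)
  (fun b => val b) (Ordinal le_bm)).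
Qed.

End Multiplicity.

(** The polynomials [r e] have pairwise coprime leading monomials [a e].  Every
    monomial factors uniquely as a product of powers of the [a e] and a standard
    monomial, divisible by none of them.  The linear map [deform] replaces each
    [a e] by [r e] in this factorization.  It is triangular for the weight, hence
    bijective, and it carries the multiplication by a power product of the [a e]
    to the multiplication by that of the [r e]: questions about the [r e] become
    questions about monomials. *)
Section CoprimeLeadingTerms.
Variables (F : fieldType) (d N : nat) (w : measure d).
Variables (a : 'I_N -> 'X_{1..d}) (r : 'I_N -> {mpoly F[d]}).
Hypothesis a_neq0 : forall e, a e != 0%MM.
Hypothesis a_coprime : forall e f v, a e v != 0%N -> a f v != 0%N -> e = f.
Hypothesis r_leads : forall e, leads w (a e) (r e).

Implicit Types (b : 'X_{1..N}) (m : 'X_{1..d}) (p q : {mpoly F[d]}).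

Definition apow b : 'X_{1..d} := (\sum_(e < N) a e *+ b e)%MM.
Definition rpow b : {mpoly F[d]} := \prod_(e < N) r e ^+ b e.
Definition amult m : 'X_{1..N} := [multinom mnm_mult (a e) m | e < N].
Definition arem m : 'X_{1..d} := (m - apow (amult m))%MM.
Definition standard m := amult m == 0%MM.

Lemma apowE b e v : a e v != 0%N -> apow b v = (a e v * b e)%N.
Proof.
move=> nz_aev; rewrite /apow mnm_sumE (bigD1 e) //= big1 ?addn0 ?mulmnE // => f.
rewrite mulmnE; case: (a f v =P 0%N) => [-> //|/eqP nz_afv].
by rewrite (a_coprime nz_aev nz_afv) eqxx.
Qed.

(** At the support of [a e], coprimality reduces [apow b] to [a e *+ b e]. *)
Lemma amultD b m : amult (apow b + m) = (b + amult m)%MM.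
Proof.
apply/mnmP => e; rewrite mnmDE !mnmE.
have leq_eq x y : (forall c, (c <= x) = (c <= y))%N -> x = y.
  by move=> eq_xy; apply/eqP; rewrite eqn_leq -eq_xy leqnn eq_xy leqnn.
apply: leq_eq => c; rewrite leq_mnm_mult // -leq_subLR leq_mnm_mult //.
apply/mnm_lepP/mnm_lepP => le_m v; move/(_ v): le_m; rewrite !mulmnE mnmDE.
  case: (a e v =P 0%N) => [-> //|/eqP nz]; rewrite (apowE _ nz); nia.
case: (a e v =P 0%N) => [-> //|/eqP nz]; rewrite (apowE _ nz); nia.
Qed.

Lemma apowD b b' : apow (b + b') = (apow b + apow b')%MM.
Proof.
rewrite /apow -big_split /=; apply: eq_bigr => e _.
by apply/mnmP => v; rewrite !(mnmDE, mulmnE) mulnDr.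
Qed.

Lemma rpowD b b' : rpow (b + b') = rpow b * rpow b'.
Proof.
by rewrite /rpow -big_split /=; apply: eq_bigr => e _; rewrite mnmDE exprD.
Qed.

Lemma apowU e : apow U_(e) = a e.
Proof.
rewrite /apow (bigD1 e) //= mnm1E eqxx mulm1n big1 ?addm0 // => f.
by rewrite mnm1E eq_sym => /negbTE->.
Qed.

Lemma rpowU e : rpow U_(e) = r e.
Proof.
rewrite /rpow (bigD1 e) //= mnm1E eqxx big1 ?mulr1 // => f.
by rewrite mnm1E eq_sym => /negbTE->.
Qed.

Lemma rpow0 : rpow 0%MM = 1.
Proof. by rewrite /rpow big1 // => e _; rewrite mnm0E. Qed.

Definition deform_mnm m := rpow (amult m) * 'X_[arem m].

Definition deform : {mpoly F[d]} -> {mpoly F[d]} := mlin deform_mnm.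

Lemma deform_mnmD b m : deform_mnm (apow b + m) = rpow b * deform_mnm m.
Proof.
rewrite /deform_mnm amultD rpowD -mulrA /arem amultD; congr (_ * (_ * 'X_[_])).
by rewrite apowD; apply/mnmP => v; rewrite !(mnmBE, mnmDE) subnDl.
Qed.

Lemma deformM b p : deform ('X_[apow b] * p) = rpow b * deform p.
Proof.
rewrite {1}[p]mpolyE mulr_sumr /deform linear_sum [in RHS]/mlin mulr_sumr.
apply: eq_bigr => m _.
by rewrite -scalerAr linearZ /= -mpolyXD mlinX deform_mnmD scalerAr.
Qed.

Lemma nonstandardP m :
  ~~ standard m -> exists e m', m = (apow U_(e) + m')%MM.
Proof.
move=> nz; have /existsP[e nz_e] : [exists e, amult m e != 0%N].
  apply: contraR nz => /existsPn z; apply/eqP/mnmP => e; rewrite mnm0E.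
  exact/eqP/negPn/z.
exists e, (m - a e)%MM; rewrite apowU addmC submK //.
by move: nz_e; rewrite mnmE -lt0n leq_mnm_mult // mulm1n.
Qed.

(** By induction on the degree: a nonstandard monomial is [a e] times a smaller
    one, and leading monomials multiply. *)
Lemma leads_deform_mnm m : leads w m (deform_mnm m).
Proof.
have [D] := ubnP (mdeg m); elim: D m => // D IHD m.
case: (boolP (standard m)) => [/eqP std _|].
  rewrite /deform_mnm /arem std rpow0 mul1r.
  have -> : apow 0 = 0%MM.
    by rewrite /apow big1 // => e _; rewrite mnm0E.
  by rewrite subm0; exact: leadsX.
move=> /nonstandardP[e [m' ->]]; rewrite mdegD ltnS => le_m'.
rewrite deform_mnmD apowU rpowU; apply: leadsM => //; apply: IHD.
have : (0 < mdeg (apow U_(e)))%N by rewrite apowU lt0n mdeg_eq0.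
by lia.
Qed.

(** A monomial of [p] of maximal weight cannot be cancelled by the images of the
    other ones. *)
Lemma deform_inj p : deform p = 0 -> p = 0.
Proof.
move=> dp0; apply/eqP; rewrite -msize_poly_eq0 msize_msupp0; apply: contraTT isT.
case Ep : (msupp p) => [//|m0 s] _.
have m0p : m0 \in msupp p by rewrite Ep mem_head.
pose m := [arg max_(i > SeqSub m0p) w (ssval i)].
have max_m m' : m' \in msupp p -> (w m' <= w (ssval m))%N.
  move=> m'p; rewrite /m; case: arg_maxnP => // i _ /(_ (SeqSub m'p)); exact.
have := congr1 (mcoeff (ssval m)) dp0; rewrite mcoeff0 /deform /mlin raddf_sum /=.
rewrite (bigD1_seq (ssval m)) ?msupp_uniq ?ssvalP //= big_seq_cond big1.
  rewrite addr0 mcoeffZ; move/eqP; apply: contraLR => _; rewrite mulf_neq0 //.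
    by rewrite -mcoeff_msupp ssvalP.
  exact/mcoeff_leads/leads_deform_mnm.
move=> m' /andP[/max_m le_m' ne]; rewrite mcoeffZ.
case: (boolP (ssval m \in msupp (deform_mnm m'))) => [mm'|/memN_msupp_eq0->].
  have := ltn_leads (leads_deform_mnm m') mm'.
  by rewrite eq_sym ne => /(_ isT); rewrite ltnNge le_m'.
exact: mulr0.
Qed.

(** By induction on the weight, since the image of a monomial is a multiple of
    this monomial up to lower weight. *)
Lemma deform_surj p : exists q, deform q = p.
Proof.
have imgE q : {in msupp q, forall m, exists q', deform q' = 'X_[m]} ->
    exists q', deform q' = q.
  move=> qE; rewrite [q]mpolyE big_seq; apply:
    (big_ind (fun p => exists q', deform q' = p)).
  - by exists 0; rewrite /deform linear0.
  - by move=> _ _ [q1 <-] [q2 <-]; exists (q1 + q2); rewrite /deform linearD.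
  - by move=> m /qE[q' <-]; exists (q@_m *: q'); rewrite /deform linearZ.
apply: (imgE) => m _; have [t] := ubnP (w m); elim: t m => // t IHt m lt_m.
have [c nz_c low] := leads_deform_mnm m.
have [m' /low lt_m'|q qE] := imgE (deform_mnm m - c *: 'X_[m]).
  by apply: IHt; lia.
exists (c^-1 *: ('X_[m] - q)); rewrite /deform linearZ linearB /= -/(deform q) qE.
by rewrite mlinX opprB addrC subrK scalerA mulVf // scale1r.
Qed.

Definition in_rideal p := exists q : 'I_N -> {mpoly F[d]}, p = \sum_e r e * q e.

Lemma in_rideal_deform p :
  {in msupp p, forall m, ~~ standard m} -> in_rideal (deform p).
Proof.
move=> nstd; rewrite /deform /mlin big_seq; apply: (big_ind in_rideal).
- by exists (fun=> 0); rewrite big1 // => e _; rewrite mulr0.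
- move=> _ _ [q1 ->] [q2 ->]; exists (fun e => q1 e + q2 e).
  by rewrite -big_split; apply: eq_bigr => e _; rewrite mulrDr.
- move=> m /nstd/nonstandardP[e [m' ->]]; rewrite deform_mnmD rpowU scalerAr.
  exists (fun f => if f == e then p@_(apow U_(e) + m') *: deform_mnm m' else 0).
  by rewrite (bigD1 e) //= eqxx big1 ?addr0 // => f /negbTE->; rewrite mulr0.
Qed.

(** The powers of the [r e] behave as independent variables over any set that
    meets their ideal only in 0.  Through [deform] the relation becomes
    [\sum_b 'X_[apow b] * H b = 0].  For [b] of minimal degree with [H b != 0] and
    a standard monomial [m], only [H b] contributes to the coefficient of
    [apow b + m]; so [H b] has no standard monomial and [G b] lies in the ideal. *)
Lemma rpow_independent (D : nat) (G : 'X_{1..N} -> {mpoly F[d]}) :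
  (forall b, in_rideal (G b) -> G b = 0) ->
  \sum_(b : 'X_{1..N < D}) rpow b * G b = 0 ->
  forall b, (mdeg b < D)%N -> G b = 0.
Proof.
move=> Gcompl sumG0.
have [H HE] : exists H : 'X_{1..N} -> {mpoly F[d]}, forall b, deform (H b) = G b.
  by have [H HE] := choice (fun b => deform_surj (G b)); exists H.
have sumH0 : \sum_(b : 'X_{1..N < D}) 'X_[apow b] * H b = 0.
  apply: deform_inj; rewrite /deform linear_sum -[RHS]sumG0; apply: eq_bigr => b _.
  by rewrite -HE -deformM.
suff H0 b : (mdeg b < D)%N -> H b = 0.
  by move=> b ltD; rewrite -HE H0 // /deform linear0.
have [t] := ubnP (mdeg b); elim: t b => // t IHt b lt_bt lt_bD.
apply: deform_inj; rewrite HE; apply: Gcompl; rewrite -HE.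
apply: in_rideal_deform => m; rewrite mcoeff_msupp; apply: contra => /eqP std.
have := congr1 (mcoeff (apow b + m)) sumH0; rewrite mcoeff0 raddf_sum /=.
rewrite (bigD1 (BMultinom lt_bD)) //= big1 => [|b' ne].
  by rewrite addr0 mulrC mcoeffMX => ->.
case: (boolP ((apow b + m)%MM \in msupp ('X_[apow b'] * H b'))) => [|/memN_msupp_eq0//].
rewrite mulrC (perm_mem (msuppMX _ _)) => /mapP[m' _ /(congr1 amult)].
rewrite !amultD std addm0 => eb.
have ne_m' : amult m' != 0%MM.
  apply: contraNneq ne => m'0; apply/eqP/val_inj; rewrite /= eb m'0.
  by apply/mnmP => v; rewrite mnmDE mnm0E addn0.
rewrite IHt ?mul0r ?mcoeff0 // ?bmdeg //; move: lt_bt; rewrite eb mdegD.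
by move: ne_m'; rewrite -mdeg_eq0; lia.
Qed.

End CoprimeLeadingTerms.

(** * The Fischer inner product *)

Section Fischer.
Variables (F : numClosedFieldType) (d : nat).
Implicit Types (p q : {mpoly F[d]}) (m : 'X_{1..d}).

Definition mfact m : nat := \prod_(i < d) (m i)`!.

Definition fischer q : {mpoly F[d]} -> F^o :=
  mlin (fun m => (q@_m)^* * (mfact m)%:R : F^o).

HB.instance Definition _ q := GRing.Linear.on (fischer q).

Lemma fischer0l p : fischer 0 p = 0.
Proof.
rewrite /fischer /mlin big1 // => m _.
by rewrite mcoeff0 rmorph0 mul0r scaler0.
Qed.

Lemma fischerDl p q1 q2 : fischer (q1 + q2) p = fischer q1 p + fischer q2 p.
Proof.
rewrite /fischer /mlin -big_split; apply: eq_bigr => m _ /=.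
by rewrite mcoeffD rmorphD mulrDl scalerDr.
Qed.

Lemma mfactS m i : mfact (m + U_(i))%MM = ((m i).+1 * mfact m)%N.
Proof.
rewrite /mfact (bigD1 i) //= [in RHS](bigD1 i) //= mulnA mnmDE mnm1E eqxx addn1.
rewrite factS; congr (_ * _)%N; apply: eq_bigr => j /negbTE ne.
by rewrite mnmDE mnm1E eq_sym ne addn0.
Qed.

(** Multiplication by a variable is adjoint to the derivation; the factorial
    weights are made for this. *)
Lemma fischerX q p i : fischer q ('X_i * p) = fischer q^`M(i) p.
Proof.
rewrite {1}[p]mpolyE mulr_sumr /fischer linear_sum; apply: eq_bigr => m _.
rewrite -scalerAr linearZ /= -mpolyXD mlinX; congr (_ *: _).
rewrite mcoeff_deriv rmorphMn addmC mfactS natrM /=.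
by rewrite mulrA -[X in _ = X * _]mulr_natr.
Qed.

Lemma fischer_eq0 q : fischer q q = 0 -> q = 0.
Proof.
have term_ge0 m : 0 <= q@_m *: ((q@_m)^* * (mfact m)%:R : F^o).
  by rewrite /GRing.scale /= mulrA mulr_ge0 ?mul_conjC_ge0 ?ler0n.
move/eqP; rewrite psumr_eq0 // => /allP q0; apply/mpolyP => m; rewrite mcoeff0.
apply/eqP; apply: contraT => nz; have := q0 m; rewrite mcoeff_msupp => /(_ nz).
rewrite /GRing.scale /= mulrA mulf_eq0 mul_conjC_eq0 (negbTE nz) /= pnatr_eq0.
suff : (0 < mfact m)%N by case: (mfact m).
by apply: prodn_gt0 => i; exact: fact_gt0.
Qed.

End Fischer.

(** * Leading monomials of the quadrics *)

Section Weights.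
Variables (d : nat) (c : 'I_d -> nat).

Definition weigh (m : 'X_{1..d}) : nat := \sum_(v < d) m v * c v.

Fact weigh0 : weigh 0%MM = 0%N.
Proof. by rewrite /weigh big1 // => v _; rewrite mnm0E. Qed.

Fact weighD : {morph weigh : m1 m2 / (m1 + m2)%MM >-> (m1 + m2)%N}.
Proof.
move=> m1 m2; rewrite /weigh -big_split; apply: eq_bigr => v _.
by rewrite mnmDE mulnDl.
Qed.

HB.instance Definition _ := isMeasure.Build d weigh weigh0 weighD.

Lemma weighU v : weigh U_(v)%MM = c v.
Proof.
rewrite /weigh (bigD1 v) //= mnm1E eqxx mul1n big1 ?addn0 // => u.
by rewrite mnm1E eq_sym => /negbTE->.
Qed.

End Weights.

(** Several indices may produce the leading monomial; in characteristic 0 their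
    number is a nonzero coefficient. *)
Lemma leads_sumX (F : numDomainType) (d : nat) (w : measure d) (I : finType)
    (f : I -> 'X_{1..d}) (m : 'X_{1..d}) (i0 : I) :
  f i0 = m -> (forall i, f i != m -> (w (f i) < w m)%N) ->
  leads w m (\sum_i 'X_[f i] : {mpoly F[d]}).
Proof.
move=> fi0 ltf; exists #|[pred i | f i == m]|%:R.
  rewrite pnatr_eq0 -lt0n; apply/card_gt0P; exists i0; exact/eqP.
rewrite (bigID (fun i => f i == m)) /=.
rewrite (eq_bigr (fun=> 'X_[m])) => [|i /eqP-> //].
rewrite sumr_const scaler_nat addrAC subrr add0r.
apply: (big_ind (below w (w m))) => [m'|p q|i ne m'].
- by rewrite msupp0.
- exact: belowD.
- by rewrite msuppX inE => /eqP->; exact: ltf.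
Qed.

Section Quadrics.
Variables (F : fieldType) (k n : nat).

Definition quad (i j : 'I_k) : {mpoly F[k * n]} :=
  \sum_(l < n) coordX F i l * coordX F j (rev_ord l).

Lemma quadC i j : quad i j = quad j i.
Proof.
rewrite /quad (reindex_inj rev_ord_inj) /=; apply: eq_bigr => l _.
by rewrite rev_ordK mulrC.
Qed.

Definition sym_pair := [pred ij : 'I_k * 'I_k | (ij.1 <= ij.2)%N].

Definition squad (e : 'I_#|sym_pair|) : {mpoly F[k * n]} :=
  quad (enum_val e).1 (enum_val e).2.

Lemma mxvec_index_inj i j l1 l2 :
  mxvec_index i l1 = mxvec_index j l2 :> 'I_(k * n) -> i = j /\ l1 = l2.
Proof.
move=> eq_il; have [g gK _] := curry_mxvec_bij k n.
have := gK (i, l1) isT; rewrite [uncurry _ _]eq_il => il.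
by have := gK (j, l2) isT; rewrite [LHS]il => -[-> ->].
Qed.

End Quadrics.

(** If [h = \sum_e r_e q_e], then [<h, h>] is the sum of the products of the
    [q_e] with the [Delta_e h], which vanish. *)
Lemma harmonic_ideal_eq0 (F : numClosedFieldType) (k n : nat)
    (h : {mpoly F[k * n]}) :
  h \in @harmonic F k n -> in_rideal (@squad F k n) h -> h = 0.
Proof.
move=> hH [q hE]; apply: fischer_eq0; rewrite {2}hE linear_sum big1 // => e _.
rewrite mulr_suml linear_sum /=.
transitivity (fischer (Delta (enum_val e).1 (enum_val e).2 h) (q e)).
  rewrite /Delta; set i := (enum_val e).1; set j := (enum_val e).2.
  rewrite (big_morph (fun h => fischer h (q e)) (fischerDl _) (fischer0l _)).
  apply: eq_bigr => l _; rewrite mderiv_comm -!fischerX.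
  by congr (fischer _ _); rewrite mulrA [X in X * _]mulrC.
have /forallP/(_ (enum_val e).1)/forallP/(_ (enum_val e).2)/implyP := hH.
move/(_ (enum_valP e))/eqP->.
exact: fischer0l.
Qed.

(** With [T := l - (h + t)], the right hand side minus the left hand side is
    [2 T (k (T + 1 - b) - t)].  Since [t < k], this is positive for every [T]
    other than 0, except when [b = 0], [t = 0] and [T = - 1].  In that case [l] is
    the column opposite to [h + t], which gives the same monomial.  The weight is
    chosen for this. *)
Lemma lead_weight_max (k n i j l h t : nat) (b : bool) :
  (i + t < k)%N -> (b + h.*2 = n.+1)%N -> (l < n.+1)%N -> (h + t <= n)%N ->
  j = (i + t)%N -> l != (h + t)%N -> (t == 0%N) && (l == n - (h + t))%N = false ->
  let W x y := ((n - y) * (k * y + (4 * k + 2) * x))%N in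
  (W i l + W j (n - l) < W i (h + t) + W j (n - (h + t)))%N.
Proof.
move=> ik nE ln htn -> ne ne0 /=.
pose W (x y : int) : int := (((n%:Z - y) * (k%:Z * y + (4 * k%:Z + 2) * x)))%R.
pose T : int := (l%:Z - h%:Z - t%:Z)%R.
have : (W i%:Z (h%:Z + t%:Z) + W (i%:Z + t%:Z) (n%:Z - h%:Z - t%:Z)
   - W i%:Z l%:Z - W (i%:Z + t%:Z) (n%:Z - l%:Z)
   = 2 * (T * (k%:Z * (T + 1 - b%:Z) - t%:Z)))%R.
  have -> : (n%:Z = b%:Z + h%:Z + h%:Z - 1)%R by lia.
  rewrite /W /T; ring.
have : (0 < T * (k%:Z * (T + 1 - b%:Z) - t%:Z))%R.
  have [lt|ge] := ltnP l (h + t).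
    have [s sE] : exists s : nat, (T = - (s%:Z + 1))%R.
      by exists ((h + t - l).-1); lia.
    have -> : (T * (k%:Z * (T + 1 - b%:Z) - t%:Z)
      = (s%:Z + 1) * (k%:Z * (s%:Z + b%:Z) + t%:Z))%R.
      by rewrite sE; ring.
    apply: mulr_gt0; first lia.
    have : (0 < k * (s + b) + t)%N by move: sE; rewrite addn_gt0 muln_gt0; lia.
    lia.
  have [s sE] : exists s : nat, (T = s%:Z + 1)%R by exists (l - (h + t)).-1; lia.
  have -> : (T * (k%:Z * (T + 1 - b%:Z) - t%:Z)
    = (s%:Z + 1) * (k%:Z * (s%:Z + (1 - b%:Z)) + (k%:Z - t%:Z)))%R.
    by rewrite sE; ring.
  apply: mulr_gt0; first lia.
  have : (0 <= k%:Z * (s%:Z + (1 - b%:Z)))%R by rewrite mulr_ge0 //; lia.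
  lia.
move=> T_gt0 WT; rewrite !subKn // -ltz_nat !(PoszD, PoszM) -!subzn // PoszD.
move: T_gt0 WT; rewrite /W => T_gt0 WT; rewrite -subr_gt0.
by rewrite -(pmulr_rgt0 _ (isT : 0 < 2 :> int)%R) -WT in T_gt0; lia.
Qed.

Section LeadingMonomials.
Variables (F : numFieldType) (k n : nat).
Hypothesis kn : (2 * k - 1 <= n.+1)%N.
Local Notation n1 := (n.+1).

(** The leading monomial of [r_ij] is [x_il x_jl'] with [l'] opposite to [l] and
    [l] shifted from the middle by [j - i].  This shift recovers [j] from [i], so
    that distinct pairs use distinct variables; it stays in range precisely when
    [2 k - 1 <= n.+1]. *)
Definition lead_col (e : 'I_#|sym_pair k|) : 'I_n1 :=
  inord (n1./2 + ((enum_val e).2 - (enum_val e).1)).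

Definition lead_mnm (e : 'I_#|sym_pair k|) : 'X_{1..k * n1} :=
  (U_(mxvec_index (enum_val e).1 (lead_col e))
   + U_(mxvec_index (enum_val e).2 (rev_ord (lead_col e))))%MM.

Definition lead_weight : 'I_(k * n1) -> nat :=
  mxvec (\matrix_(i < k, l < n1) ((n - l) * (k * l + (4 * k + 2) * i))%N) 0.

Lemma lead_colE e :
  lead_col e = (n1./2 + ((enum_val e).2 - (enum_val e).1))%N :> nat.
Proof.
rewrite inordK //; have := ltn_ord (enum_val e).2; have := odd_double_half n1; lia.
Qed.

Lemma lead_weightE i l :
  lead_weight (mxvec_index i l) = ((n - l) * (k * l + (4 * k + 2) * i))%N.
Proof. by rewrite /lead_weight mxvecE mxE. Qed.

Lemma lead_mnm_neq0 e : lead_mnm e != 0%MM.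
Proof. by rewrite mnmD_eq0 mnm1_eq0. Qed.

(** The column of a variable gives the shift and its row one member of the pair,
    so the variable determines the pair.  A column can only play both roles,
    [lead_col e] and the opposite of some [lead_col f], in the middle, where the
    shifts are 0. *)
Lemma lead_mnm_coprime e f v :
  lead_mnm e v != 0%N -> lead_mnm f v != 0%N -> e = f.
Proof.
have lead_mnmP g : lead_mnm g v != 0%N ->
    v = mxvec_index (enum_val g).1 (lead_col g) \/
    v = mxvec_index (enum_val g).2 (rev_ord (lead_col g)).
  rewrite mnmDE !mnm1E addn_eq0 negb_and !eqb0 !negbK.
  by case/orP => /eqP->; [left | right].
move=> /lead_mnmP ve /lead_mnmP vf; apply: enum_val_inj.
have colE := lead_colE; have n2 := odd_double_half n1.
move: n1./2 (odd n1) colE n2 => h b colE n2.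
have := ltn_ord (lead_col e); have := ltn_ord (lead_col f).
have := enum_valP e; have := enum_valP f; have := colE e; have := colE f.
rewrite !inE; case: (enum_val e) ve => i1 j1 /= ve.
case: (enum_val f) vf => i2 j2 /= vf.
move: vf; case: ve => -> [] /mxvec_index_inj[] + /(congr1 val) /= => /(congr1 val) /=.
all: by move=> *; congr pair; apply: val_inj => /=; lia.
Qed.

Lemma squad_leads e :
  leads (weigh lead_weight) (lead_mnm e) (squad F n1 e).
Proof.
pose i := (enum_val e).1; pose j := (enum_val e).2.
pose f l := (U_(mxvec_index i l) + U_(mxvec_index j (rev_ord l)))%MM : 'X_{1..k * n1}.
have -> : squad F n1 e = \sum_(l < n1) 'X_[f l].
  by apply: eq_bigr => l _; rewrite /coordX -mpolyXD.
apply: (@leads_sumX _ _ _ _ f _ (lead_col e)) => // l ne.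
rewrite /f /lead_mnm !mfD /= !weighU !lead_weightE /= !subSS.
have lc := lead_colE e; have ij := enum_valP e; rewrite inE in ij.
rewrite lc -/i -/j.
have n2 := odd_double_half n1.
apply: (lead_weight_max (b := odd n1)) => //; rewrite -/i -/j.
- by have := ltn_ord j; rewrite -/i -/j in ij *; lia.
- by rewrite -ltnS -lc.
- by rewrite subnKC.
- apply: contraNneq ne => le; rewrite /f /lead_mnm.
  by have -> : l = lead_col e by exact/val_inj/(etrans le).
- apply: contraNF ne => /andP[/eqP d0 /eqP le].
  have eij : i = j.
    by apply: val_inj; move: ij d0; rewrite -/i -/j /=; clearbody i j; lia.
  have -> : l = rev_ord (lead_col e) by apply: val_inj; rewrite /= lc subSS.
  by rewrite /f /lead_mnm rev_ordK addmC -/i -/j eij.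
Qed.

End LeadingMonomials.

(** * Reflections of the orthogonal group *)

Section Form.
Variables (A : comNzRingType) (n : nat).

Definition antidiag : 'M[A]_n := \matrix_(l, m) (m == rev_ord l)%:R.

Lemma mul_antidiagE m (X : 'M[A]_(m, n)) i l : (X *m antidiag) i l = X i (rev_ord l).
Proof.
rewrite mxE (bigD1 (rev_ord l)) //= mxE rev_ordK eqxx mulr1 big1 ?addr0 // => j ne.
by rewrite mxE -(inj_eq rev_ord_inj) rev_ordK eq_sym (negbTE ne) mulr0.
Qed.

Lemma antidiagK : antidiag *m antidiag = 1%:M.
Proof.
by apply/matrixP => i j; rewrite mul_antidiagE !mxE (inj_eq rev_ord_inj) eq_sym.
Qed.

Lemma mul_antidiagK m (X : 'M[A]_(m, n)) : X *m antidiag *m antidiag = X.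
Proof. by rewrite -mulmxA antidiagK mulmx1. Qed.

Lemma tr_antidiag : antidiag^T = antidiag.
Proof.
apply/matrixP => i j; rewrite !mxE.
by rewrite -(inj_eq rev_ord_inj) rev_ordK eq_sym.
Qed.

Definition gram m (X : 'M[A]_(m, n)) : 'M[A]_m := X *m antidiag *m X^T.

Lemma tr_gram m (X : 'M[A]_(m, n)) : (gram X)^T = gram X.
Proof. by rewrite /gram !trmx_mul trmxK tr_antidiag mulmxA. Qed.

End Form.

Arguments antidiag {A n}.

Section OrthogonalGroup.
Variables (F : fieldType) (n : nat).
Implicit Types (g : 'M[F]_n).

Lemma antiformE (u v : 'cV[F]_n) : antiform u v = (u^T *m antidiag *m v) 0 0.
Proof.
rewrite /antiform mxE (reindex_inj rev_ord_inj); apply: eq_bigr => l _.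
by rewrite mul_antidiagE mxE rev_ordK.
Qed.

Lemma in_OnP g : in_On g <-> g *m antidiag *m g^T = antidiag.
Proof.
have tr_iff : g *m antidiag *m g^T = antidiag <-> g^T *m antidiag *m g = antidiag.
  by split => gJ; (have := congr1 (mulmx^~ antidiag) gJ);
    rewrite /= antidiagK -!mulmxA => /mulmx1C;
    move=> /(congr1 (mulmx antidiag)); rewrite /= !mulmxA antidiagK mul1mx mulmx1.
rewrite tr_iff; split => [gO | gJ u v].
  have entry (B : 'M[F]_n) i j :
      ((delta_mx i 0 : 'cV_n)^T *m B *m (delta_mx j 0 : 'cV_n)) 0 0 = B i j.
    by rewrite trmx_delta -colE mxE -rowE mxE.
  apply/matrixP => i j; rewrite -!entry -antiformE -gO antiformE trmx_mul.
  by rewrite !mulmxA.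
by rewrite !antiformE trmx_mul -[in RHS]gJ !mulmxA.
Qed.

(** The reflection [v |-> v - 2 (v, u) / (u, u) u] in the vector [u = x - y]
    exchanges two vectors of the same length; replacing [u] by the rows of
    [D = X - Y] gives the orthogonal map [1 - J D^T M^-1 D], where
    [M = X J D^T].  Its orthogonality is
    the identity [D J D^T = M + M^T], a consequence of the equality of the Gram
    matrices. *)
Lemma block_reflection m (X Y : 'M[F]_(m, n)) :
  gram X = gram Y -> X *m antidiag *m (X - Y)^T \in unitmx ->
  exists2 g, in_On g & X *m g = Y /\
    forall k (Z : 'M[F]_(k, n)), Z *m antidiag *m (X - Y)^T = 0 -> Z *m g = Z.
Proof.
set D := X - Y; set M := X *m antidiag *m D^T => eqG uM.
have DJD : D *m antidiag *m D^T = M + M^T.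
  have DT : D^T = X^T - Y^T by rewrite linearB.
  rewrite /M !trmx_mul trmxK tr_antidiag mulmxA DT /D !(mulmxBl, mulmxBr).
  rewrite -/(gram X) -/(gram Y) -eqG.
  move: (gram X) (X *m _ *m _) (Y *m _ *m _) => a b c.
  by apply/matrixP => i j; rewrite !mxE; ring.
have ME : X *m antidiag *m D^T = M by [].
have YE : X - D = Y by rewrite opprB addrC subrK.
clearbody M; clearbody D; pose R := antidiag *m D^T *m invmx M *m D.
exists (1%:M - R).
  apply/in_OnP; rewrite linearB /= trmx1 mulmxBl mul1mx mulmxBr mulmx1 mulmxBl.
  have RT : R^T = D^T *m invmx M^T *m D *m antidiag.
    by rewrite /R 3!trmx_mul trmxK tr_antidiag trmx_inv !mulmxA.
  have -> : R *m antidiag *m R^T = antidiag *m R^T + R *m antidiag.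
    have key : invmx M *m (M + M^T) *m invmx M^T = invmx M^T + invmx M.
      by rewrite mulmxDr mulmxDl mulVmx // mul1mx mulmxK ?unitmx_tr.
    transitivity (antidiag *m D^T *m (invmx M *m (M + M^T) *m invmx M^T)
      *m D *m antidiag).
      by rewrite -DJD RT /R !mulmxA.
    by rewrite key RT /R mulmxDr !mulmxDl !mulmxA.
  by rewrite opprB [_ + R *m _ - _]addrAC subrr add0r subrK.
split=> [|j Z ZD].
  by rewrite mulmxBr mulmx1 /R !mulmxA ME mulmxV // mul1mx.
by rewrite mulmxBr mulmx1 /R !mulmxA ZD !mul0mx subr0.
Qed.

End OrthogonalGroup.

(** * Evaluation at matrices and matrices with a given Gram matrix *)

Section Evaluation.
Variables (F : fieldType) (k n : nat).
Implicit Types (X : 'M[F]_(k, n)) (p : {mpoly F[k * n]}).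

Definition meval_mx X p : F := p.@[mxvec X 0].

HB.instance Definition _ X := GRing.RMorphism.copy (meval_mx X) (meval (mxvec X 0)).

Lemma map_genericX X : map_mx (meval_mx X) (genericX F k n) = X.
Proof. by apply/matrixP => i j; rewrite !mxE /meval_mx /coordX mevalXU mxvecE. Qed.

Lemma meval_quad X i j : meval_mx X (quad F n i j) = gram X i j.
Proof.
rewrite /quad rmorph_sum /gram mxE (reindex_inj rev_ord_inj); apply: eq_bigr => l _.
by rewrite rmorphM /= mul_antidiagE mxE /meval_mx /coordX !mevalXU !mxvecE rev_ordK.
Qed.

Lemma meval_On_act X g p : meval_mx X (On_act g p) = meval_mx (X *m g) p.
Proof.
rewrite /On_act /mpoly_subst /meval_mx comp_mpoly_meval; apply: meval_eq => v.
rewrite tnth_mktuple; case/mxvec_indexP: v => i j; rewrite !mxvecE.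
rewrite -[X in X *m g]map_genericX -/(meval_mx X _) mxE rmorph_sum mxE.
apply: eq_bigr => l _; rewrite rmorphM; congr (_ * _); first by rewrite [RHS]mxE.
by rewrite mxE; exact: mevalC.
Qed.

End Evaluation.

Lemma meval_mx_inj (F : numFieldType) (k n : nat) (p q : {mpoly F[k * n]}) :
  (forall X : 'M_(k, n), meval_mx X p = meval_mx X q) -> p = q.
Proof.
move=> eq_pq; apply/eqP; rewrite -subr_eq0; apply/eqP/mpoly_eq0_meval => v.
have vE : v =1 mxvec (vec_mx (\row_i v i)) 0 by move=> i; rewrite vec_mxK mxE.
by rewrite (meval_eq _ vE) rmorphB /= [X in X - _]eq_pq subrr.
Qed.

Lemma gram_On (F : fieldType) m n (g : 'M[F]_n) (X : 'M_(m, n)) :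
  in_On g -> gram (X *m g) = gram X.
Proof.
by move=> /in_OnP gO; rewrite /gram trmx_mul !mulmxA -[in RHS]gO !mulmxA.
Qed.

Lemma quad_invariant (F : numFieldType) k n (i j : 'I_k) :
  quad F n i j \in @Defs.invariant F k n.
Proof.
apply/asboolP => g gO; apply: meval_mx_inj => X.
by rewrite meval_On_act !meval_quad gram_On.
Qed.

(** A polynomial is determined by its values, so invariance can be tested on
    matrices over [F]. *)
Lemma invariant_evalP (F : numFieldType) k n (p : {mpoly F[k * n]}) :
  p \in @Defs.invariant F k n <->
  forall g X, in_On g -> meval_mx (X *m g) p = meval_mx X p.
Proof.
split=> [/asboolP pI g X gO | pI]; first by rewrite -meval_On_act pI.
by apply/asboolP => g gO; apply: meval_mx_inj => X; rewrite meval_On_act pI.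
Qed.

Section GramSection.
Variables (A : comNzRingType) (k' n : nat).
Local Notation k := (k'.+1).
Variables (h : A) (r : 'M[A]_k) (s : A).

Definition sec_top : 'M[A]_(k, n) :=
  \matrix_(i, l) ((i < k')%N && (l == i :> nat))%:R.

Definition sec_coef : 'M[A]_k :=
  \matrix_(i, j) ((if i == ord_max then 1 else h) * r i j).

(** The two indicators coincide when [n = 2 k - 1]; both cases give a vector of
    nonzero length. *)
Definition sec_vec : 'rV[A]_n :=
  \row_l ((l == k' :> nat)%:R + (rev_ord l == k' :> nat)%:R).

(** For [r] symmetric and [h = 1 / 2], row [i < k - 1] is [e_i] plus half the
    combination of the opposite isotropic vectors [e_(n + 1 - j)] with coefficients
    [r_ij]; the last row has full coefficients and the component [s] along a vector
    orthogonal to these hyperbolic planes.  The scalar [h] is a parameter since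
    the same formula is used over fields and over polynomial rings. *)
Definition gram_section : 'M[A]_(k, n) :=
  sec_top + sec_coef *m sec_top *m antidiag + s *: (delta_mx ord_max 0 *m sec_vec).

Definition sec_norm : A := gram sec_vec 0 0.

Hypothesis kn : (k' + k' < n)%N.

(** Two columns below [k'] are never opposite, since [k' + k' < n]. *)
Lemma sec_top_isotropic : gram sec_top = 0.
Proof.
apply/matrixP => i j; rewrite /gram mxE big1 ?mxE // => l _.
rewrite mul_antidiagE !mxE -natrM mulnb /=.
case: andP => // -[/andP[ik /eqP li] /andP[jk /eqP lj]].
by exfalso; lia.
Qed.

Lemma sec_vec_antidiag : sec_vec *m antidiag = sec_vec.
Proof.
by apply/matrixP => i l; rewrite mul_antidiagE !mxE rev_ordK addrC.
Qed.

Lemma sec_top_vec : sec_top *m sec_vec^T = 0.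
Proof.
apply/matrixP => i j; rewrite mxE big1 ?mxE // => l _; rewrite !mxE.
case: andP => [[ik /eqP li]|_]; last by rewrite mul0r.
rewrite /= -natrD; case: eqP => [|_]; first by lia.
by case: eqP => [|_]; [lia | rewrite mulr0].
Qed.

Lemma sec_top_gram i j : (sec_top *m sec_top^T) i j = ((i == j) && (i < k')%N)%:R.
Proof.
have [lt_i|ge_i] := ltnP i k'; last first.
  rewrite andbF mxE big1 // => l _.
  by rewrite !mxE ltnNge ge_i mul0r.
have lt_in : (i < n)%N by lia.
rewrite mxE (bigD1 (Ordinal lt_in)) //= big1 ?addr0 => [|l ne].
  rewrite !mxE -[i == j]val_eqE /= eqxx lt_i /= mul1r andbT.
  by case: eqP => [<-|_]; rewrite ?lt_i ?andbF.
rewrite !mxE; case: (l =P i :> nat) => [li|_]; last by rewrite andbF mul0r.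
by case/eqP: ne; apply: val_inj.
Qed.

End GramSection.

(** Of the nine blocks of the product only those pairing a hyperbolic vector
    with its opposite, and the last vector with itself, survive.  Keeping [s] and
    [t] apart serves both the Gram matrix and the point where general position is
    checked. *)
Lemma gram_section_mul (A : comNzRingType) (k' n : nat) (h : A)
    (r : 'M[A]_k'.+1) (s t : A) :
  (k' + k' < n)%N -> h + h = 1 -> r^T = r ->
  gram_section n h r s *m antidiag *m (gram_section n h r t)^T
  = \matrix_(i, j) (if (i == ord_max) && (j == ord_max) then s * t * sec_norm A k' n
                    else r i j).
Proof.
move=> kn hh rT; rewrite /gram_section.
set E := sec_top A k' n; set K := sec_coef h r; set v := sec_vec A k' n.
have EJE : E *m antidiag *m E^T = 0 by exact: sec_top_isotropic.
have Ev : E *m v^T = 0 by exact: sec_top_vec.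
have vJ : v *m antidiag = v by exact: sec_vec_antidiag.
have EJv : E *m antidiag *m v^T = 0.
  by rewrite -mulmxA -[X in _ *m (X *m _)]tr_antidiag -trmx_mul vJ.
have vv : v *m v^T = (sec_norm A k' n)%:M.
  by rewrite /sec_norm /gram -/v vJ [LHS]mx11_scalar.
clearbody v.
pose S := E + K *m E *m antidiag.
have ST : S^T = E^T + antidiag *m E^T *m K^T.
  by rewrite /S linearD /= !trmx_mul tr_antidiag mulmxA.
have SJ : S *m antidiag = E *m antidiag + K *m E.
  by rewrite /S mulmxDl mul_antidiagK.
have KEJE : K *m E *m antidiag *m E^T = 0.
  by rewrite -!mulmxA [E *m (_ *m _)]mulmxA EJE mulmx0.
have SJS : S *m antidiag *m S^T = E *m E^T *m K^T + K *m (E *m E^T).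
  rewrite SJ ST !(mulmxDl, mulmxDr) !mulmxA EJE mul_antidiagK KEJE.
  by rewrite mul0mx add0r addr0.
have SJv : S *m antidiag *m v^T = 0.
  by rewrite SJ mulmxDl EJv -mulmxA Ev mulmx0 addr0.
have vJS : v *m antidiag *m S^T = 0.
  by apply: trmx_inj; rewrite 2!trmx_mul trmxK tr_antidiag trmx0 mulmxA SJv.
pose c : 'cV[A]_k'.+1 := delta_mx ord_max 0.
rewrite -/S -/c; clear SJ ST; clearbody S.
have -> : (S + s *: (c *m v)) *m antidiag *m (S + t *: (c *m v))^T
   = E *m E^T *m K^T + K *m (E *m E^T) + (s * t * sec_norm A k' n) *: (c *m c^T).
  rewrite linearD linearZ /= trmx_mul !(mulmxDl, mulmxDr) SJS -!addrA.
  congr (_ + (_ + _)).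
  rewrite -!scalemxAr -!scalemxAl !mulmxA SJv mul0mx scaler0 add0r.
  rewrite -!(mulmxA c) vJS mulmx0 scaler0 add0r mulmxA vJ -!(mulmxA c) vv.
  by rewrite mul_scalar_mx -scalemxAr !scalerA [t * s]mulrC.
have DK (B : 'M[A]_k'.+1) i j : (E *m E^T *m B) i j = (i < k')%:R * B i j.
  rewrite mxE (bigD1 i) //= sec_top_gram // eqxx /= big1 ?addr0 // => l ne.
  by rewrite sec_top_gram // eq_sym (negbTE ne) mul0r.
have KD i j : (K *m (E *m E^T)) i j = (j < k')%:R * K i j.
  rewrite mxE (bigD1 j) //= sec_top_gram // eqxx /= big1 ?addr0 => [|l ne].
    by rewrite mulrC.
  by rewrite sec_top_gram // (negbTE ne) mulr0.
have maxE (i : 'I_k'.+1) : (i < k')%N = (i != ord_max).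
  by have := ltn_ord i; rewrite -val_eqE /=; lia.
have rC i j : r j i = r i j by rewrite -[in RHS]rT mxE.
apply/matrixP => i j.
rewrite /c trmx_delta mul_delta_mx [LHS]mxE [X in X + _]mxE DK KD !maxE !mxE rC.
case: eqP => [_|_]; case: eqP => [_|_] /=;
  rewrite !(mul0r, mul1r, mulr0, mulr1, add0r, addr0) //.
by rewrite -mulrDl hh mul1r.
Qed.

Lemma gram_sectionE (A : comNzRingType) (k' n : nat) (h : A) (r : 'M[A]_k'.+1) (s : A) :
  gram_section n h r s
  = gram_section n h r 0 + s *: (delta_mx ord_max 0 *m sec_vec A k' n).
Proof. by rewrite /gram_section scale0r addr0. Qed.

Lemma gram_section_vec (A : comNzRingType) (k' n : nat) (h : A) (r : 'M[A]_k'.+1) :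
  (k' + k' < n)%N ->
  gram_section n h r 0 *m antidiag *m (sec_vec A k' n)^T = 0.
Proof.
move=> kn; rewrite /gram_section scale0r addr0 -mulmxA.
rewrite -[antidiag in X in _ *m X]tr_antidiag -trmx_mul sec_vec_antidiag.
rewrite mulmxDl sec_top_vec // add0r -mulmxA.
rewrite -[antidiag in X in _ *m X]tr_antidiag -trmx_mul sec_vec_antidiag.
by rewrite -mulmxA sec_top_vec // mulmx0.
Qed.

Lemma map_antidiag (A B : comNzRingType) (f : {rmorphism A -> B}) n :
  map_mx f antidiag = antidiag :> 'M_n.
Proof. by apply/matrixP => i j; rewrite !mxE rmorph_nat. Qed.

Lemma map_gram (A B : comNzRingType) (f : {rmorphism A -> B}) m n (X : 'M_(m, n)) :
  map_mx f (gram X) = gram (map_mx f X).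
Proof. by rewrite /gram !map_mxM map_antidiag map_trmx. Qed.

Lemma map_gram_section (A B : comNzRingType) (f : {rmorphism A -> B}) (k' n : nat)
    (h : A) (r : 'M[A]_k'.+1) (s : A) :
  map_mx f (gram_section n h r s) = gram_section n (f h) (map_mx f r) (f s).
Proof.
rewrite /gram_section !(map_mxD, map_mxM, map_mxZ) map_delta_mx.
have -> : map_mx f (sec_top A k' n) = sec_top B k' n.
  by apply/matrixP => i j; rewrite !mxE rmorph_nat.
rewrite map_antidiag.
have -> : map_mx f (sec_vec A k' n) = sec_vec B k' n.
  by apply/matrixP => i j; rewrite !mxE rmorphD !rmorph_nat.
have -> // : map_mx f (sec_coef h r) = sec_coef (f h) (map_mx f r).
by apply/matrixP => i j; rewrite !mxE rmorphM; case: ifP => // _; rewrite rmorph1.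
Qed.

Lemma sec_norm_neq0 (F : numDomainType) (k' n : nat) :
  (k' + k' < n)%N -> sec_norm F k' n != 0.
Proof.
move=> kn; have lt_k'n : (k' < n)%N by lia.
have -> : sec_norm F k' n
    = (\sum_(l < n) ((l == k' :> nat) + (rev_ord l == k' :> nat)) ^ 2)%:R.
  rewrite natr_sum /sec_norm /gram sec_vec_antidiag mxE; apply: eq_bigr => l _.
  by rewrite !mxE natrX natrD.
rewrite pnatr_eq0 -lt0n (bigD1 (Ordinal lt_k'n)) //= eqxx.
by rewrite addn_gt0 expn_gt0 addn_gt0.
Qed.

(** * The invariants are polynomials in the quadrics *)

Lemma invariant_gram (F : numFieldType) k n (p : {mpoly F[k * n]}) (X Y : 'M_(k, n)) :
  p \in @Defs.invariant F k n -> gram X = gram Y ->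
  X *m antidiag *m (X - Y)^T \in unitmx -> meval_mx X p = meval_mx Y p.
Proof.
move=> /invariant_evalP pI eqG /(block_reflection eqG)[g gO [<- _]].
by rewrite pI.
Qed.

(** The reflection in the last vector of the section changes the sign of [s] and
    fixes everything else. *)
Lemma invariant_sign (F : numFieldType) k' n (p : {mpoly F[k'.+1 * n]}) h r s :
  (k' + k' < n)%N -> p \in @Defs.invariant F k'.+1 n ->
  meval_mx (gram_section n h r s) p = meval_mx (gram_section n h r (- s)) p.
Proof.
move=> kn /invariant_evalP pI; pose v := sec_vec F k' n.
have vD : v - - v = 2 *: v by rewrite opprK scaler_nat.
have [| |g gO [vg fixg]] := @block_reflection F n 1 v (- v).
- by rewrite /gram linearN /= mulNmx mulNmx mulmxN opprK.
- rewrite vD linearZ /= -scalemxAr unitmxE det_mx11 mxE.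
  by rewrite unitfE mulf_neq0 ?pnatr_eq0 //; exact: sec_norm_neq0.
rewrite -(pI g) //; congr meval_mx.
rewrite gram_sectionE [RHS]gram_sectionE mulmxDl; congr (_ + _).
  by rewrite fixg // vD linearZ /= -scalemxAr gram_section_vec // scaler0.
by rewrite -scalemxAl -mulmxA vg mulmxN scalerN scaleNr.
Qed.

(** The determinant is affine in the last column. *)
Lemma det_addC_last (F : numFieldType) k' (M : 'M[F]_k'.+1) (u : 'cV_k'.+1) :
  \det (M - u *m delta_mx 0 ord_max) + \det (M + u *m delta_mx 0 ord_max)
  = 2 * \det M.
Proof.
rewrite -(det_tr M) (@determinant_multilinear _ _ M^T
  (M - u *m delta_mx 0 ord_max)^T (M + u *m delta_mx 0 ord_max)^T
  ord_max 2^-1 2^-1).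
- by rewrite !det_tr -mulrDr mulrA mulfV ?mul1r // pnatr_eq0.
- rewrite -scalerDr -linearD /= -linearD /= addrACA addNr addr0 -mulr2n.
  by rewrite -scaler_nat !linearZ /= scalerA mulfV ?scale1r // pnatr_eq0.
- apply/matrixP => i j; rewrite !mxE big_ord1 !mxE.
  by rewrite [_ == ord_max]eq_sym (negbTE (neq_lift _ _)) andbF mulr0 subr0.
apply/matrixP => i j; rewrite !mxE big_ord1 !mxE.
by rewrite [_ == ord_max]eq_sym (negbTE (neq_lift _ _)) andbF mulr0 addr0.
Qed.

Lemma horner_even_odd (A B : comNzRingType) (f : {rmorphism A -> B}) (p : {poly A}) t :
  (map_poly f p).[t] = (map_poly f (even_poly p)).[t ^+ 2]
                       + (map_poly f (odd_poly p)).[t ^+ 2] * t.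
Proof.
rewrite -[in LHS](poly_even_odd p) rmorphD rmorphM /= !map_comp_poly map_polyXn.
by rewrite map_polyX hornerD hornerM hornerX !horner_comp hornerXn.
Qed.

Section FirstFundamentalTheorem.
Variables (F : numClosedFieldType) (k' n : nat).
Local Notation k := (k'.+1).
Hypothesis kn : (k' + k' < n)%N.

Local Notation half := (2^-1 : F).
Local Notation kap := (sec_norm F k' n).

Fact halfE : half + half = 1.
Proof. by rewrite -mulr2n -[_ *+ 2]mulr_natr mulVf // pnatr_eq0. Qed.

Lemma gram_gram_section (G : 'M[F]_k) s :
  G^T = G -> s ^+ 2 * kap = G ord_max ord_max -> gram (gram_section n half G s) = G.
Proof.
move=> GT sG; rewrite /gram gram_section_mul ?halfE //.
by apply/matrixP => i j; rewrite mxE -expr2; case: ifP => // /andP[/eqP-> /eqP->].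
Qed.

(** The determinant of this matrix expresses general position: [X] is exchanged
    with [gram_section n h (gram X) s] by a block reflection if a rank one
    perturbation of it, depending on the sign of [s], is invertible. *)
Definition generic_mx (A : comNzRingType) (X : 'M[A]_(k, n)) (h : A) : 'M[A]_k :=
  gram X - X *m antidiag *m (gram_section n h (gram X) 0)^T.

(** By det_addC_last the perturbations for [s] and [- s] are not both singular,
    and invariant_sign makes the choice immaterial. *)
Lemma invariant_gram_section (p : {mpoly F[k * n]}) (X : 'M_(k, n)) :
  p \in @Defs.invariant F k n -> \det (generic_mx X half) != 0 ->
  exists2 s, s ^+ 2 * kap = gram X ord_max ord_max &
    meval_mx X p = meval_mx (gram_section n half (gram X) s) p.
Proof.
move=> pI nzd; pose s := sqrtC (gram X ord_max ord_max / kap).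
have sE : s ^+ 2 * kap = gram X ord_max ord_max.
  by rewrite sqrtCK divfK // sec_norm_neq0.
pose u := X *m antidiag *m (s *: sec_vec F k' n)^T.
have MsE t : X *m antidiag *m (X - gram_section n half (gram X) (t * s))^T
    = generic_mx X half - t *: u *m delta_mx 0 ord_max.
  rewrite gram_sectionE opprD addrA linearB /= mulmxBr.
  rewrite linearB /= mulmxBr -/(gram X) -/(generic_mx X half) /u; congr (_ - _).
  by rewrite !linearZ /= trmx_mul trmx_delta mulmxA -!scalemxAl scalerA mulrC.
have unit_s t : (t * s) ^+ 2 * kap = gram X ord_max ord_max ->
    \det (generic_mx X half - t *: u *m delta_mx 0 ord_max) != 0 ->
    meval_mx X p = meval_mx (gram_section n half (gram X) (t * s)) p.
  move=> tsE nz; apply: invariant_gram => //; last by rewrite unitmxE unitfE MsE.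
  by rewrite gram_gram_section // tr_gram.
exists s => //; have := det_addC_last (generic_mx X half) u.
have [det0|nz _] := eqVneq (\det (generic_mx X half - u *m delta_mx 0 ord_max)) 0.
  rewrite det0 add0r => det2; rewrite invariant_sign // -mulN1r; apply: unit_s.
    by rewrite mulN1r sqrrN.
  by rewrite scaleN1r mulNmx opprK det2 mulf_neq0 // pnatr_eq0.
by rewrite -[s]mul1r; apply: unit_s; rewrite ?mul1r // scale1r.
Qed.

(** At minus a section with Gram matrix 1 the matrix is diagonal, with
    entries 2 and a last entry 1. *)
Lemma generic_mx_neq0 : exists X : 'M[F]_(k, n), \det (generic_mx X half) != 0.
Proof.
pose s := sqrtC (kap^-1); have sE : s ^+ 2 * kap = 1.
  by rewrite sqrtCK mulVf // sec_norm_neq0.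
pose Y : 'M_(k, n) := gram_section n half 1%:M s; exists (- Y).
have GY : gram Y = 1%:M by rewrite gram_gram_section ?trmx1 // mxE eqxx.
have -> : generic_mx (- Y) half = diag_mx (\row_i (if i == ord_max then 1 else 2)).
  have -> : generic_mx (- Y) half
      = 1%:M + Y *m antidiag *m (gram_section n half 1%:M 0)^T.
    have GNY : gram (- Y) = 1%:M by rewrite -GY /gram linearN /= !mulNmx mulmxN opprK.
    by rewrite /generic_mx GNY !mulNmx opprK.
  rewrite gram_section_mul ?halfE ?trmx1 //; apply/matrixP => i j; rewrite !mxE.
  case: (i =P j) => [<-|ne]; last first.
    case: eqP => [ei|_]; case: eqP => [ej|_]; rewrite ?mulr0 ?mul0r ?add0r //.
  by case: eqP => _ /=; rewrite ?mulr0 ?mul0r ?addr0.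
rewrite det_diag; apply/prodf_neq0 => i _; rewrite mxE.
by case: ifP => _; rewrite ?oner_neq0 ?pnatr_eq0.
Qed.

Lemma squad_onto : exists idx : 'I_k * 'I_k -> 'I_#|sym_pair k|,
  forall i j, squad F n (idx (i, j)) = quad F n i j.
Proof.
have onto (ij : 'I_k * 'I_k) : exists e, squad F n e = quad F n ij.1 ij.2.
  case: ij => i j.
  have [le_ij|/ltnW le_ji] := leqP i j.
    have ijP : (i, j) \in sym_pair k by [].
    by exists (enum_rank_in ijP (i, j)); rewrite /squad enum_rankK_in.
  have jiP : (j, i) \in sym_pair k by [].
  by exists (enum_rank_in jiP (j, i)); rewrite /squad enum_rankK_in //= quadC.
by have [idx idxE] := choice onto; exists idx => i j; exact: idxE.
Qed.

(** The first fundamental theorem of invariant theory for the orthogonal group, in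
    the range where the section exists.  Substituting the section with formal
    entries [rho] and ['X] in [p] gives a polynomial [pY] in ['X]; its even part, with
    the square of ['X] replaced by a multiple of the last diagonal entry of [rho],
    is the required expression.  The two sides agree where the determinant [D] does
    not vanish, hence everywhere. *)
Lemma invariant_squad (p : {mpoly F[k * n]}) :
  p \in @Defs.invariant F k n ->
  exists f : {mpoly F[#|sym_pair k|]}, p = f \mPo [tuple squad F n e | e < _].
Proof.
move=> pI; have [idx idxE] := squad_onto.
pose Q := {mpoly F[#|sym_pair k|]}.
pose rho : 'M[Q]_k := \matrix_(i, j) 'X_(idx (i, j)).
pose C : {rmorphism F -> {poly Q}} := polyC \o @mpolyC _ F.
pose Y : 'M[{poly Q}]_(k, n) := gram_section n (C half) (map_mx polyC rho) 'X.
pose pY : {poly Q} := mmap C (mxvec Y 0) p.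
exists (even_poly pY).[kap^-1 *: rho ord_max ord_max].
set f := _.[_].
pose D := \det (generic_mx (genericX F k n) (half%:MP)).
have evalD X : meval_mx X D = \det (generic_mx X half).
  rewrite /D -det_map_mx /generic_mx map_mxB map_gram 2!map_mxM -map_trmx.
  rewrite map_gram_section map_antidiag map_gram map_genericX rmorph0.
  have halfC : meval_mx X half%:MP = half by exact: mevalC.
  by rewrite /= halfC.
have nzD : D != 0.
  have [X nzX] := generic_mx_neq0; apply: contraNneq nzX => D0.
  by rewrite -evalD D0 rmorph0.
apply: (mulfI nzD); apply: meval_mx_inj => X; rewrite !rmorphM /= evalD.
have [->|nzX] := eqVneq (\det (generic_mx X half)) 0; first by rewrite !mul0r.
congr (_ * _).
have [s sE ->] := invariant_gram_section pI nzX.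
pose vG e := meval_mx X (squad F n e).
have -> : meval_mx X (f \mPo [tuple squad F n e | e < _]) = f.@[vG].
  by rewrite /meval_mx comp_mpoly_meval; apply: meval_eq => e; rewrite tnth_mktuple.
pose psi t : {rmorphism {poly Q} -> F} := horner_eval t \o map_poly (meval vG).
have psiE t : psi t pY = meval_mx (gram_section n half (gram X) t) p.
  have psiY : map_mx (psi t) Y = gram_section n half (gram X) t.
    rewrite map_gram_section /psi /= /horner_eval map_polyC map_polyX /=.
    rewrite hornerC hornerX mevalC; congr gram_section; apply/matrixP => i j.
    rewrite mxE [map_mx polyC _ _ _]mxE [rho _ _]mxE /= map_polyC hornerC /=.
    by rewrite mevalXU /vG idxE meval_quad.
  rewrite -psiY /meval_mx mevalE rmorph_sum; apply: eq_bigr => m _.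
  rewrite rmorphM rmorph_prod; congr (_ * _).
    by rewrite /= /horner_eval map_polyC hornerC /= mevalC.
  by apply: eq_bigr => v _; rewrite rmorphXn -map_mxvec mxE.
have psi_split t : t ^+ 2 = s ^+ 2 ->
    psi t pY = f.@[vG] + (map_poly (meval vG) (odd_poly pY)).[s ^+ 2] * t.
  have fE : f.@[vG] = (map_poly (meval vG) (even_poly pY)).[s ^+ 2].
    rewrite /f -horner_map /=; congr (_.[_]); rewrite mevalZ mxE mevalXU /vG idxE.
    by rewrite meval_quad -sE mulrCA mulVf ?mulr1 // sec_norm_neq0.
  by move=> tE; rewrite fE -tE -horner_even_odd.
have psi_sum : psi s pY + psi (- s) pY = 2 * f.@[vG].
  by rewrite !psi_split ?sqrrN // mulrN addrACA subrr addr0 mulr_natl.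
apply: (@mulfI _ 2); first by rewrite pnatr_eq0.
by rewrite -psi_sum !psiE -invariant_sign // mulr_natl.
Qed.

End FirstFundamentalTheorem.

(** * Injectivity for large n *)

Lemma tens_suml (F : fieldType) (U V : lmodType F) (I : Type) (s : seq I)
    (P : pred I) (u : I -> U) (v : V) :
  tens (\sum_(i <- s | P i) u i) v = \sum_(i <- s | P i) tens (u i) v.
Proof.
apply: (big_morph (fun u => tens u v)) => [u1 u2|]; first exact: tensDl.
by rewrite -(scale0r (0 : U)) tensZl scale0r.
Qed.

Lemma tens_sumr (F : fieldType) (U V : lmodType F) (I : Type) (s : seq I)
    (P : pred I) (u : U) (v : I -> V) :
  tens u (\sum_(i <- s | P i) v i) = \sum_(i <- s | P i) tens u (v i).
Proof.
apply: (big_morph (tens u)) => [v1 v2|]; first exact: tensDr.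
by rewrite -(scale0r (0 : V)) tensZr scale0r.
Qed.

Lemma rpow_squad_invariant (F : numFieldType) k n (b : 'X_{1..#|sym_pair k|}) :
  rpow (@squad F k n) b \in @Defs.invariant F k n.
Proof.
apply/invariant_evalP => g X gO; rewrite /rpow !rmorph_prod; apply: eq_bigr => e _.
by rewrite !rmorphXn /= !meval_quad gram_On.
Qed.

(** Expanding the invariants in powers of the quadrics puts every tensor in the
    form [\sum_b tens (rinv b) (G b)], with harmonic [G b]. *)
Lemma mul_IH_inj (F : numClosedFieldType) (k' n' : nat) :
  (2 * k'.+1 - 1 <= n'.+1)%N -> injective (@mul_IH F k'.+1 n'.+1).
Proof.
move=> kn; have kn' : (k' + k' < n'.+1)%N by lia.
set N := #|sym_pair k'.+1|.
pose rinv b := Invariant (@rpow_squad_invariant F k'.+1 n'.+1 b).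
apply: raddf_inj => t; have [s ->] := tens_sumE t.
have [f fE] := choice (fun u : invariants F k'.+1 n'.+1 =>
  invariant_squad kn' (valP u)).
pose D := (\max_(x <- s) msize (f x.1))%N.
pose G b : harmonics F k'.+1 n'.+1 := \sum_(x <- s) (f x.1)@_b *: x.2.
have -> : \sum_(x <- s) tens x.1 x.2
    = \sum_(b : 'X_{1..N < D}) tens (rinv b) (G b).
  rewrite (eq_bigr (fun b : 'X_{1..N < D} =>
     \sum_(x <- s) (f x.1)@_b *: tens (rinv b) x.2)); last first.
    by move=> b _; rewrite /G tens_sumr; apply: eq_bigr => x _; rewrite tensZr.
  rewrite exchange_big /=; apply: eq_big_seq => x xs.
  have {1}-> : x.1 = \sum_(b : 'X_{1..N < D}) (f x.1)@_b *: rinv b.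
    apply: val_inj; rewrite raddf_sum /= {1}fE (@comp_mpolywE _ _ _ _ _ D).
      apply: eq_bigr => b _; congr (_ *: _).
      by apply: eq_bigr => e _; rewrite tnth_mktuple.
    exact: (@leq_bigmax_seq _ s xpredT (fun x => msize (f x.1))).
  by rewrite tens_suml; apply: eq_bigr => b _; rewrite tensZl.
rewrite raddf_sum /= => sum0; apply: big1 => b _.
have G0 : val (G b) = 0.
  apply: (@rpow_independent _ _ _ (weigh (@lead_weight k'.+1 n')) (@lead_mnm _ _)
    (@squad F k'.+1 n'.+1) (@lead_mnm_neq0 _ _) (lead_mnm_coprime kn)
    (squad_leads F kn) D (fun b => val (G b))) (bmdeg b).
    by move=> b'; apply: harmonic_ideal_eq0; exact: (valP (G b')).
  by rewrite -[RHS]sum0; apply: eq_bigr => b' _; rewrite mul_IH_tens.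
have -> : G b = 0 by apply: val_inj.
by rewrite -(scale0r (0 : harmonics _ _ _)) tensZr scale0r.
Qed.

(** * A kernel element for small n *)

Section DerivativeOfDeterminant.
Variables (F : fieldType) (d : nat).
Implicit Types (p q : {mpoly F[d]}) (u v : 'I_d).

Lemma mderivM_eq0 u p q : p^`M(u) = 0 -> q^`M(u) = 0 -> (p * q)^`M(u) = 0.
Proof. by move=> pu qu; rewrite mderivM pu qu mul0r mulr0 addr0. Qed.

Lemma mderiv_sign u m : ((-1) ^+ m : {mpoly F[d]})^`M(u) = 0.
Proof.
elim: m => [|m IHm]; first by rewrite expr0 -mpolyC1 mderivC.
by rewrite exprS mderivM_eq0 // mderivN -mpolyC1 mderivC oppr0.
Qed.

Lemma mderiv_det_eq0 u m (M : 'M[{mpoly F[d]}]_m) :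
  (forall i j, (M i j)^`M(u) = 0) -> (\det M)^`M(u) = 0.
Proof.
move=> M0; rewrite /determinant linear_sum big1 // => s _ /=.
rewrite mderivM_eq0 ?mderiv_sign //.
apply: (big_ind (fun p => p^`M(u) = 0)) => //; last exact: mderivM_eq0.
by rewrite -mpolyC1 mderivC.
Qed.

Lemma mderiv_cofactor_eq0 u m (M : 'M[{mpoly F[d]}]_m) i0 j0 :
  (forall i j, j != j0 -> (M i j)^`M(u) = 0) -> (cofactor M i0 j0)^`M(u) = 0.
Proof.
move=> M0; rewrite /cofactor mderivM_eq0 ?mderiv_sign //.
by apply: mderiv_det_eq0 => i j; rewrite !mxE M0 // eq_sym neq_lift.
Qed.

(** Expand along column [j0], whose entries are the only ones that are not
    annihilated: the determinant has degree one in them. *)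
Lemma mderiv2_det_eq0 u v m (M : 'M[{mpoly F[d]}]_m) j0 :
  (forall i j, j != j0 -> (M i j)^`M(u) = 0) ->
  (forall i j, j != j0 -> (M i j)^`M(v) = 0) ->
  (forall i, (M i j0)^`M(u)^`M(v) = 0) ->
  (\det M)^`M(u)^`M(v) = 0.
Proof.
move=> Mu Mv Muv.
rewrite (expand_det_col M j0) (linear_sum (mderiv u)) (linear_sum (mderiv v)) /=.
rewrite big1 // => i _.
have cu : (cofactor M i j0)^`M(u) = 0 by apply: mderiv_cofactor_eq0.
rewrite mderivM cu mulr0 addr0 mderivM Muv mul0r add0r.
by rewrite [X in _ * X]mderiv_cofactor_eq0 // mulr0.
Qed.

End DerivativeOfDeterminant.

Section MinorVector.
Variables (A : comNzRingType) (k' n' : nat).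
Local Notation k := (k'.+1).
Local Notation n := (n'.+1).
Implicit Types (X : 'M[A]_(k, n)).

(** Only the first [q] columns matter to the cofactors along the last one, so the
    value of [inord q] when [q] is out of range is harmless. *)
Definition corner X q : 'M[A]_q.+1 := \matrix_(i, l) X (inord i) (inord l).

Definition minor_vec X q (i : 'I_q.+1) : A := cofactor (corner X q) i ord_max.

(** Cramer's rule: an off-diagonal entry of the product of a matrix by its
    adjugate is 0. *)
Lemma minor_vec_col X q (l : 'I_n) : (l < q)%N ->
  \sum_(i < q.+1) minor_vec X i * X (inord i) l = 0.
Proof.
move=> lq.
have := congr1 (fun M : 'M_q.+1 => M ord_max (inord l)) (mul_adj_mx (corner X q)).
rewrite !mxE (_ : (ord_max == inord l :> 'I_q.+1) = false); last first.
  by apply/negbTE; rewrite -val_eqE /= inordK; lia.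
move=> E; rewrite -[RHS]E; apply: eq_bigr => i _; rewrite !mxE; congr (_ * X _ _).
by apply: val_inj; rewrite /= inordK // inordK; have := ltn_ord l; lia.
Qed.

(** The sum factors over the columns [l], and one of the two factors vanishes:
    the second if [l < b], the first otherwise, as then [rev_ord l < a]. *)
Lemma minor_vec_gram X (a b : nat) : (a + b = n)%N ->
  \sum_(i < a.+1) \sum_(j < b.+1)
    gram X (inord i) (inord j) * (minor_vec X i * minor_vec X j) = 0.
Proof.
move=> abn.
transitivity (\sum_(l < n) (\sum_(i < a.+1) minor_vec X i * X (inord i) (rev_ord l))
    * (\sum_(j < b.+1) minor_vec X j * X (inord j) l)).
  under [RHS]eq_bigr => l _ do rewrite mulr_suml.
  rewrite [RHS]exchange_big /=; apply: eq_bigr => i _.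
  under [RHS]eq_bigr => l _ do rewrite mulr_sumr.
  rewrite [RHS]exchange_big /=; apply: eq_bigr => j _.
  rewrite /gram mxE mulr_suml; apply: eq_bigr => l _.
  by rewrite mul_antidiagE mxE; ring.
apply: big1 => l _; case: (ltnP l b) => [lb|bl].
  by rewrite [X in _ * X]minor_vec_col ?mulr0.
by rewrite [X in X * _]minor_vec_col ?mul0r //=; have := ltn_ord l; lia.
Qed.

End MinorVector.

Lemma map_minor_vec (A B : comNzRingType) (f : {rmorphism A -> B}) k' n'
    (X : 'M[A]_(k'.+1, n'.+1)) q (i : 'I_q.+1) :
  f (minor_vec X i) = minor_vec (map_mx f X) i.
Proof.
rewrite /minor_vec -cofactor_map_mx; congr cofactor.
by apply/matrixP => u v; rewrite !mxE.
Qed.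

(** Deleting row 0 and the last column of a shifted identity leaves an identity. *)
Lemma minor_vec_shift (A : comNzRingType) k' n' q : (q < k'.+1)%N -> (q <= n'.+1)%N ->
  minor_vec (\matrix_(i < k'.+1, l < n'.+1) (i == l.+1 :> nat)%:R : 'M[A]_(_, _))
    (ord0 : 'I_q.+1) = (-1) ^+ q.
Proof.
move=> qk qn; rewrite /minor_vec /cofactor /= add0n.
rewrite (_ : row' _ _ = 1%:M) ?det1 ?mulr1 //.
apply/matrixP => i l; rewrite !mxE.
have il := ltn_ord i; have ll := ltn_ord l.
have -> : (inord (lift (ord0 : 'I_q.+1) i) : 'I_k'.+1) = i.+1 :> nat.
  by rewrite inordK lift0 //; apply: leq_ltn_trans qk.
have -> : (inord (lift (ord_max : 'I_q.+1) l) : 'I_n'.+1) = l :> nat.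
  by rewrite inordK lift_max //; apply: leq_trans qn.
by rewrite eqSS.
Qed.

Section HarmonicMinors.
Variables (F : fieldType) (k' n' : nat).
Local Notation k := (k'.+1).
Local Notation n := (n'.+1).
Local Notation minor := (minor_vec (genericX F k n)).

Lemma mderiv_coordX (i j : 'I_k) (l m : 'I_n) :
  (coordX F i l)^`M(mxvec_index j m) = ((i == j) && (l == m))%:R.
Proof.
rewrite /coordX mderivX mnm1E.
case: eqP => [/mxvec_index_inj[-> ->]|ne].
  rewrite !eqxx scale1r.
  have -> : (U_(mxvec_index j m) - U_(mxvec_index j m))%MM = 0%MM.
    by apply/mnmP => v; rewrite mnmBE subnn mnm0E.
  by rewrite mpolyX0.
by rewrite scale0r; case: andP => // -[/eqP ei /eqP el]; case: ne; rewrite ei el.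
Qed.

Lemma mderiv_minor q (i : 'I_q.+1) (x : 'I_k) (l : 'I_n) : (q <= n)%N ->
  (q <= l)%N -> (minor i)^`M(mxvec_index x l) = 0.
Proof.
move=> qn ql; apply: mderiv_cofactor_eq0 => y m; rewrite -val_eqE /= => ne_m.
have mq : (m < q)%N by have := ltn_ord m; lia.
rewrite !mxE mderiv_coordX; case: andP => // -[_ /eqP/(congr1 val)] /=.
by rewrite inordK; lia.
Qed.

Lemma mderiv2_minor q (i : 'I_q.+1) (x y : 'I_k) (l : 'I_n) : (q <= n)%N ->
  (minor i)^`M(mxvec_index x l)^`M(mxvec_index y l) = 0.
Proof.
move=> qn; have [lq|ql] := ltnP l q; last by rewrite mderiv_minor // linear0.
rewrite /minor_vec /cofactor mderivM mderiv_sign mul0r add0r.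
rewrite mderivM mderiv_sign mul0r add0r.
have liftE (m : 'I_q) : inord (lift (ord_max : 'I_q.+1) m) = inord m :> 'I_n.
  by rewrite lift_max.
have inord_eq (m : 'I_q) : (inord m == l :> 'I_n) = (m == Ordinal lq).
  by rewrite -!val_eqE /= inordK //; have := ltn_ord m; lia.
rewrite (@mderiv2_det_eq0 _ _ _ _ _ _ (Ordinal lq)) ?mulr0 // => [z m ne|z m ne|z].
- by rewrite !mxE mderiv_coordX liftE inord_eq (negbTE ne) andbF.
- by rewrite !mxE mderiv_coordX liftE inord_eq (negbTE ne) andbF.
- by rewrite !mxE mderiv_coordX -mpolyC_nat mderivC.
Qed.

(** Each term of [Delta] differentiates in two opposite columns.  One of them is
    absent from both minors, except for the middle column when [n] is odd, where
    the first minor is linear and the second constant. *)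
Lemma minors_harmonic a b (i : 'I_a.+1) (j : 'I_b.+1) :
  (b <= a <= b.+1)%N -> (a + b = n)%N -> minor i * minor j \in @harmonic F k n.
Proof.
move=> /andP[ba ab] abn; apply/'forall_forallP => x y; apply/implyP => _; apply/eqP.
apply: big1 => l _; have ln := ltn_ord l.
have [an bn] : (a <= n /\ b <= n)%N by lia.
have [al|la] := leqP a l.
  rewrite mderiv_comm mderivM_eq0 ?linear0 // mderiv_minor //; lia.
have [arl|rla] := leqP a (rev_ord l).
  rewrite mderivM_eq0 ?linear0 // mderiv_minor //=; move: arl => /=; lia.
have rl : rev_ord l = l by apply: val_inj; move: rla => /=; lia.
have bl : (b <= l)%N by move: rla => /=; lia.
have d0 z : (minor j)^`M(mxvec_index z l) = 0 by exact: mderiv_minor.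
by rewrite rl mderivM d0 mulr0 addr0 mderivM d0 mulr0 addr0 mderiv2_minor // mul0r.
Qed.

End HarmonicMinors.

(** The tensor is detected by evaluating the invariants at a matrix [Z] whose Gram
    matrix has a single nonzero entry, and the harmonic polynomials at a matrix
    [X] where the corresponding minors are [1] up to sign. *)
Lemma mul_IH_inj_bound (F : numFieldType) (k' n' : nat) :
  injective (@mul_IH F k'.+1 n'.+1) -> (2 * k'.+1 - 1 <= n'.+1)%N.
Proof.
move=> inj; rewrite leqNgt; apply/negP => lt_nk.
pose b := n'.+1./2; pose a := (n'.+1 - b)%N.
have n2 := odd_double_half n'.+1; rewrite -/b in n2.
have abn : (a + b = n'.+1)%N by lia.
have ba : (b <= a <= b.+1)%N by rewrite /a; lia.
have ak : (a < k'.+1)%N by lia.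
pose H (i : 'I_a.+1) (j : 'I_b.+1) : harmonics F k'.+1 n'.+1 :=
  Harmonic (minors_harmonic F k' i j ba abn).
pose I i j : invariants F k'.+1 n'.+1 := Invariant (@quad_invariant F k'.+1 n'.+1 i j).
pose t := \sum_(i < a.+1) \sum_(j < b.+1) tens (I (inord i) (inord j)) (H i j).
have t0 : t = 0.
  apply: inj; rewrite raddf0 /t raddf_sum /=.
  rewrite -[RHS](minor_vec_gram (genericX F _ _) abn).
  apply: eq_bigr => i _; rewrite raddf_sum; apply: eq_bigr => j _.
  rewrite /= mul_IH_tens /=; congr (_ * _).
  rewrite /quad /gram mxE (reindex_inj rev_ord_inj); apply: eq_bigr => l _.
  by rewrite mul_antidiagE !mxE rev_ordK.
pose Z : 'M[F]_(k'.+1, n'.+1) := \matrix_(i, l) (i == ord0)%:R.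
pose X : 'M[F]_(k'.+1, n'.+1) := \matrix_(i, l) (i == l.+1 :> nat)%:R.
pose f (p : invariants F k'.+1 n'.+1) (h : harmonics F k'.+1 n'.+1) : F^o :=
  meval_mx Z (val p) * meval_mx X (val h).
have fl h : linear (f^~ h).
  by move=> c p1 p2; rewrite /f linearP rmorphD /= mulrDl /meval_mx mevalZ -mulrA.
have fr p : linear (f p).
  by move=> c h1 h2; rewrite /f linearP rmorphD /= mulrDr /meval_mx mevalZ mulrCA.
have gramZ i j : gram Z i j = ((i == ord0) && (j == ord0))%:R * n'.+1%:R.
  rewrite /gram mxE (eq_bigr (fun=> ((i == ord0) && (j == ord0))%:R)) => [|l _].
    by rewrite sumr_const card_ord mulr_natr.
  by rewrite mul_antidiagE !mxE -natrM mulnb.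
have inord_neq0 q (i : 'I_q) : (q < k'.+1)%N ->
    (inord (lift ord0 i) == ord0 :> 'I_k'.+1) = false.
  by move=> qk; rewrite -val_eqE [\val _]inordK ?lift0 //; apply: leq_ltn_trans qk.
pose L : {linear _ -> F^o} := HB.pack (tensor_lift f)
  (GRing.isLinear.Build _ _ _ _ _ (tensor_lift_linear fl fr)).
have : tensor_lift f t = n'.+1%:R * ((-1) ^+ a * (-1) ^+ b).
  have fIH (i : 'I_a.+1) (j : 'I_b.+1) :
      f (I (inord i) (inord j)) (H i j) = ((i == ord0) && (j == ord0))%:R
      * (n'.+1%:R * (minor_vec X i * minor_vec X j)).
    rewrite /f /= meval_quad rmorphM /= !map_minor_vec !map_genericX gramZ -mulrA.
    congr ((_ && _)%:R * _).
      have [->|] := eqVneq i ord0; first by apply/eqP/val_inj; rewrite /= inordK.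
      by case: (unliftP ord0 i) => [i' ->|->]; rewrite ?eqxx // inord_neq0.
    have [->|] := eqVneq j ord0; first by apply/eqP/val_inj; rewrite /= inordK.
    case: (unliftP ord0 j) => [j' ->|->]; rewrite ?eqxx // inord_neq0 //; lia.
  have -> : tensor_lift f t = \sum_(i < a.+1) \sum_(j < b.+1)
      ((i == ord0) && (j == ord0))%:R * (n'.+1%:R * (minor_vec X i * minor_vec X j)).
    rewrite -[tensor_lift f]/(L : _ -> _) /t (linear_sum L); apply: eq_bigr => i _.
    rewrite (linear_sum L); apply: eq_bigr => j _.
    by rewrite -fIH; exact: tensor_liftE.
  rewrite (bigD1 ord0) //= [X in _ + X]big1 => [|i /negbTE i0]; last first.
    by apply: big1 => j _; rewrite i0 mul0r.
  rewrite addr0 (bigD1 ord0) //= [X in _ + X]big1 => [|j /negbTE j0]; last first.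
    by rewrite j0 mul0r.
  by rewrite addr0 mul1r !minor_vec_shift //; lia.
rewrite t0; have -> : tensor_lift f 0 = 0.
  exact: (linear0 L).
by move/esym/eqP; rewrite mulf_eq0 pnatr_eq0 mulf_eq0 !signr_eq0.
Qed.

(** * The theorem *)

Theorem theorem3p1 (R : realType) (n k : nat) (hn : (1 <= n)%N) (hk : (1 <= k)%N) :
  injective (@mul_IH R[i] k n) <-> (2 * k - 1 <= n)%N.
Proof.
case: n hn => // n' _; case: k hk => // k' _; split.
  exact: mul_IH_inj_bound.
exact: mul_IH_inj.
Qed.
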